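(* Let $G$ be a graph and let $\mathcal{U} = \{U_1, \ldots, U_m\}$ be a partition of $V(G)$. Suppose that (a) $(G, \mathcal{U})$ is minimally RGD, (b) $G$ is a disjoint union of complete bipartite graphs, and (c) $G$ has exactly $|\mathcal{U}|$ connected components. Then $(G,\mathcal{U})$ is either an elementary non-reconfigurable instance, or can be obtained from an elementary non-reconfigurable instance by iterating finitely many times the following operation: given the current instance $(G',\mathcal{U}')$ and a block $U\in\mathcal{U}'$, add a new disjoint complete bipartite graph $K_{A,B}$ (with parts $A,B$), partition $U$ arbitrarily into two sets $X,Y$, and replace the block $U$ by the two blocks $A\cup X$ and $B\cup Y$, giving $(G'\cup K_{A,B},\ (\mathcal{U}'-\{U\})\cup\{A\cup X, B\cup Y\})$.
   Context: For a graph $G$ and a partition $\mathcal{U}$ of $V(G)$, an independent transversal (IT) of $(G,\mathcal{U})$ is an independent set of $G$ containing exactly one vertex from each block. The reconfiguration graph $\mathbf{RG}(G,\mathcal{U})$ has the IT's as vertices, two IT's $S,T$ being adjacent if $S\cup T$ is an independent set of size $|\mathcal{U}|+1$. When $G,\mathcal{U}$ are empty, $\mathbf{RG}$ is a single vertex. $G-U$ is $G$ with the vertices of $U$ deleted. $(G,\mathcal{U})$ is minimally RGD if $\mathbf{RG}(G,\mathcal{U})$ is nonempty and disconnected, but $\mathbf{RG}(G-U_i,\mathcal{U}-\{U_i\})$ is connected for all $U_i\in\mathcal{U}$. An elementary non-reconfigurable instance is a pair $(G,\mathcal{U})$ where $G$ is a disjoint union of $m$ complete bipartite graphs $K_{A_1,B_1}\sqcup\cdots\sqcup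 K_{A_m,B_m}$, $\mathcal{U}=\{U_1,\dots,U_m\}$ is a partition of $V(G)$ such that each block $U_i$ can be associated with a distinct component $K_{A_i,B_i}$ with $A_i\subseteq U_i$, and $\mathbf{RG}(G-U_i,\mathcal{U}-\{U_i\})$ is connected for all $U_i\in\mathcal{U}$. *)

(* Defs.v *)
From mathcomp Require Import all_boot.
From Stdlib Require Import Relation_Operators.

Set Implicit Arguments.
Unset Strict Implicit.
Unset Printing Implicit Defensive.

(* Finite graphs whose vertices are drawn from an ambient finite type T.  The
   vertex set is an arbitrary subset of T, so that deleting vertices and adding
   new components both stay inside graph T and equality of graphs is literal. *)
Record graph (T : finType) :=
  Graph { vset : {set T}; edges : {set {set T}} }.

Section Graphs.

Variable T : finType.
Implicit Types (G H : graph T) (U : {set {set T}}) (A B S W X Y : {set T}).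

Definition simple_graph G : bool :=
  [forall e in edges G, (e \subset vset G) && (#|e| == 2)].

Definition adj G : rel T := [rel x y | [set x; y] \in edges G].

Definition num_components G : nat := n_comp (adj G) (vset G).

Definition del_vertices G W : graph T :=
  Graph (vset G :\: W) [set e in edges G | [disjoint e & W]].

Definition graph_union G H : graph T :=
  Graph (vset G :|: vset H) (edges G :|: edges H).

Definition complete_bipartite A B : graph T :=
  Graph (A :|: B) [set [set a; b] | a in A, b in B].

(* A and B are the two parts of a complete bipartite graph. *)
Definition bipartition_parts A B : Prop :=
  [/\ A != set0, B != set0 & [disjoint A & B]].

Definition disjoint_union_Kab G (n : nat) (A B : 'I_n -> {set T}) : Prop :=
  [/\ forall i, bipartition_parts (A i) (B i),
      forall i j, i != j -> [disjoint A i :|: B i & A j :|: B j]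
    & G = \big[graph_union/Graph set0 set0]_(i < n)
            complete_bipartite (A i) (B i)].

Definition independent G S : bool :=
  (S \subset vset G) && [forall e in edges G, ~~ (e \subset S)].

Definition is_IT G U S : bool :=
  independent G S && [forall W in U, #|S :&: W| == 1].

Definition RG_adj G U : rel {set T} :=
  [rel S S' | [&& is_IT G U S, is_IT G U S', independent G (S :|: S')
                & #|S :|: S'| == #|U|.+1]].

Definition RG_nonempty G U : Prop := exists S, is_IT G U S.

(* The empty reconfiguration graph counts as connected here.  This convention
   is immaterial below: in minimally_RGD and in elementary, the reconfiguration
   graphs required to be connected automatically have a vertex. *)
Definition RG_connected G U : Prop :=
  forall S S', is_IT G U S -> is_IT G U S' -> connect (RG_adj G U) S S'.

Definition minimally_RGD G U : Prop :=
  [/\ RG_nonempty G U, ~ RG_connected G U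
    & forall W, W \in U -> RG_connected (del_vertices G W) (U :\ W)].

(* Injectivity of P makes it a bijective indexing of the blocks of U by the
   components of G. *)
Definition elementary G U : Prop :=
  partition U (vset G) /\
  exists (m : nat) (A B P : 'I_m -> {set T}),
    [/\ disjoint_union_Kab G A B,
        injective P /\ U = [set P i | i : 'I_m],
        forall i, A i \subset P i
      & forall i, RG_connected (del_vertices G (P i)) (U :\ P i)].

(* X and Y may be empty. *)
Inductive split_block : graph T * {set {set T}} -> graph T * {set {set T}} -> Prop :=
| SplitBlock G U W A B X Y :
    W \in U ->
    bipartition_parts A B -> [disjoint A :|: B & vset G] ->
    X :|: Y = W -> [disjoint X & Y] ->
    split_block (G, U)
      (graph_union G (complete_bipartite A B),
       (U :\ W) :|: [set A :|: X; B :|: Y]).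

End Graphs.

(* Main.v *)
(** Record an independent transversal by the component and the side it uses in
each block.  The heart of the proof is the claim that, when there are as many
blocks as components, every block of a minimally RGD instance contains a full
side of some component.  Granting it, suppose that some component has its two
sides in two distinct blocks: deleting it and merging the two blocks undoes one
split and preserves all hypotheses.  If there is no such component, sending each
block to a component one of whose sides it contains is injective, hence
bijective, and the instance is elementary.

For the claim, let P be a minimal nonempty set of blocks that fully contains at
least |P| components, and let K be the set of those components.  Every proper
nonempty part Q of P touches at least |Q| + 1 components of K, which is enough to
reconfigure P freely as soon as it has one more vertex at its disposal.  So if the
instance is disconnected then |K| = |P|, no transversal of the blocks outside P
leaves a vertex outside K available to P, and P is disconnected inside K.  A block
of P without a private side would make P connected inside K.  A block outside P is
handled by collapsing P to one block with the vertices outside K: by minimality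
the result has no transversal, but acquires one when any block is deleted. *)

Require Import Defs.
From mathcomp Require Import all_boot.
From Stdlib Require Import Relation_Operators.

Set Implicit Arguments.
Unset Strict Implicit.
Unset Printing Implicit Defensive.

(** When a tight set of blocks occupies all of its components, no place is free, and the only way to
    gain one is to let two blocks share a side. A block k without a private side makes this
    possible: wherever k stands, another block touches the same side and can join it there. If that
    block comes from inside the set, it vacates its own component, and the free place can then be
    passed along. [release] turns this into a tool for both kinds of block: either a block waiting
    outside can enter, or every component can be emptied. It is used with the blocks still in
    disagreement as waiting blocks when k lies in P, and with a single displaced block in the
    collapsed instance when k lies outside P. The collapsed instance has one block more than it has
    components, so the question there is the existence of a transversal and not connectedness.

    Splits can be undone without loss because two blocks owning opposite sides of a component cannot
    both stand on it: one of them always uses a vertex that survives in the merged block. *)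

Lemma connect_inv (V : finType) (e : rel V) (Q : V -> Prop) x y :
  (forall a b, Q a -> e a b -> Q b) -> Q x -> connect e x y -> Q y.
Proof.
move=> He + /connectP[p + ->]; elim: p x => //= z p IH x Qx /andP[exz pz].
exact: IH (He _ _ Qx exz) pz.
Qed.

(** * Transversals of labels and free components *)

Section Reconfiguration.

Variables I J : finType.
Implicit Types (t : I -> J * bool -> bool) (D E P Q M X : {set I})
  (S T F : {ffun I -> J * bool}) (x y : J * bool).

(* A label (j, b) stands for side b of component j; [t i x] says that block i has
   a vertex on side x.  Only the values of S on the set D of blocks matter. *)
Definition compatible x y := (x.1 == y.1) ==> (x == y).

Definition IT t D S :=
  [forall i in D, t i (S i)]
  && [forall i in D, forall i' in D, compatible (S i) (S i')].

(* Several blocks may change at once: if the union of two transversals is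
   independent, the blocks can be changed one at a time. *)
Definition reconf t D : rel {ffun I -> J * bool} :=
  [rel S T | [&& IT t D S, IT t D T
               & [forall i in D, forall i' in D, compatible (S i) (T i')]]].

Definition upd S i x : {ffun I -> J * bool} :=
  [ffun i' => if i' == i then x else S i'].

Definition patch F P S : {ffun I -> J * bool} :=
  [ffun i => if i \in P then S i else F i].

Definition used_comps S D : {set J} := [set (S i).1 | i in D].

Definition touched t Q : {set J} := [set j | [exists i in Q, exists b, t i (j, b)]].

Lemma compatibleP x y : reflect (x.1 = y.1 -> x = y) (compatible x y).
Proof.
apply: (iffP implyP) => h; first by move/eqP/h/eqP.
by move/eqP/h/eqP.
Qed.

Lemma ITP t D S :
  reflect ((forall i, i \in D -> t i (S i)) /\
           (forall i i', i \in D -> i' \in D -> (S i).1 = (S i').1 -> S i = S i'))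
          (IT t D S).
Proof.
apply: (iffP andP) => -[h1 h2]; split.
- by move=> i Di; apply: (implyP (forallP h1 i)).
- move=> i i' Di Di'; apply/compatibleP.
  by apply: (implyP (forallP (implyP (forallP h2 i) Di) i')).
- by apply/forall_inP.
- apply/forall_inP=> i Di; apply/forall_inP=> i' Di'; apply/compatibleP; exact: h2.
Qed.

Lemma reconfP t D S T :
  reflect [/\ IT t D S, IT t D T &
           forall i i', i \in D -> i' \in D -> (S i).1 = (T i').1 -> S i = T i']
          (reconf t D S T).
Proof.
apply: (iffP and3P) => -[h1 h2 h3]; split=> //.
  move=> i i' Di Di'; apply/compatibleP.
  by apply: (implyP (forallP (implyP (forallP h3 i) Di) i')).
apply/forall_inP=> i Di; apply/forall_inP=> i' Di'; apply/compatibleP; exact: h3.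
Qed.

Lemma touchedP t Q j : reflect (exists i b, i \in Q /\ t i (j, b)) (j \in touched t Q).
Proof.
rewrite inE; apply: (iffP exists_inP) => [[i Qi /existsP[b tb]]|[i [b [Qi tb]]]].
  by exists i, b.
by exists i => //; apply/existsP; exists b.
Qed.

Lemma updE S i x : upd S i x i = x.
Proof. by rewrite ffunE eqxx. Qed.

Lemma updN S i x i' : i' != i -> upd S i x i' = S i'.
Proof. by rewrite ffunE => /negPf->. Qed.

Lemma reconf_sym t D : symmetric (reconf t D).
Proof.
move=> S T; apply/reconfP/reconfP => -[h1 h2 h3]; split=> // i i' Di Di' e;
  by symmetry; apply: h3.
Qed.

Lemma conn_sym t D : connect_sym (reconf t D).
Proof. exact: (sym_connect_sym (reconf_sym t D)). Qed.

Lemma IT_eq t D S T : {in D, S =1 T} -> IT t D S -> IT t D T.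
Proof.
move=> eST /ITP[h1 h2]; apply/ITP; split=> [i Di|i i' Di Di'].
  by rewrite -eST //; apply: h1.
by rewrite -!eST //; apply: h2.
Qed.

Lemma reconf_eq t D S T : {in D, S =1 T} -> IT t D S -> reconf t D S T.
Proof.
move=> eST iS; apply/reconfP; split=> //; first exact: IT_eq eST iS.
by move=> i i' Di Di'; rewrite -!eST //; case/ITP: iS => _; apply.
Qed.

Lemma IT_sub t D P S : P \subset D -> IT t D S -> IT t P S.
Proof.
move=> /subsetP PD /ITP[h1 h2]; apply/ITP; split=> [i /PD|]; first exact: h1.
by move=> i i' /PD Di /PD; apply: h2.
Qed.

Lemma IT_mono t t' D S :
  (forall i x, i \in D -> t i x -> t' i x) -> IT t D S -> IT t' D S.
Proof.
move=> tt' /ITP[h1 h2]; apply/ITP; split=> // i Di; apply: tt' => //; exact: h1.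
Qed.

Lemma conn_sub t D P S T :
  P \subset D -> connect (reconf t D) S T -> connect (reconf t P) S T.
Proof.
move=> PD; apply: connect_sub => {}S {}T /reconfP[h1 h2 h3]; apply: connect1.
apply/reconfP; split; [exact: IT_sub PD h1|exact: IT_sub PD h2|].
by move=> i i' /(subsetP PD) Di /(subsetP PD); apply: h3.
Qed.

Lemma conn_IT t D S T : IT t D S -> connect (reconf t D) S T -> IT t D T.
Proof.
by apply: (connect_inv (Q := fun T => IT t D T)) => S1 S2 _ /reconfP[].
Qed.

Lemma reconf_upd t D S i x : IT t D S -> t i x ->
  (forall i', i' \in D -> (S i').1 = x.1 -> S i' = x) -> reconf t D S (upd S i x).
Proof.
move=> iS tx hx; case/ITP: (iS) => h1 h2; apply/reconfP; split=> //.
  apply/ITP; split=> [k Dk|k k' Dk Dk'].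
    by rewrite ffunE; case: eqP => [->|_] //; apply: h1.
  rewrite !ffunE; case: eqP => _; case: eqP => _ // e; last exact: h2.
    by symmetry; apply: hx.
  exact: hx.
by move=> k k' Dk Dk'; rewrite ffunE; case: eqP => _; [apply: hx|apply: h2].
Qed.

(** F is frozen outside P, and [t'] is any restriction of the labels on P that rules out conflicts
    with F. It is a parameter because it will be the labels inside K, those avoiding a set of
    components, or those compatible with a fixed outer transversal. *)
Lemma patch_IT t t' D P F S : P \subset D -> IT t (D :\: P) F ->
  (forall i x, i \in P -> t' i x -> t i x /\
     forall e, e \in D :\: P -> x.1 = (F e).1 -> x = F e) ->
  IT t' P S -> IT t D (patch F P S).
Proof.
move=> PD /ITP[f1 f2] h /ITP[s1 s2]; apply/ITP.
have hin i : i \in D -> i \notin P -> i \in D :\: P by move=> *; apply/setDP.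
split=> [i Di|i i' Di Di']; rewrite !ffunE.
  case: ifPn => Pi; last by apply: f1; apply: hin.
  by case: (h i (S i) Pi (s1 _ Pi)).
case: ifPn => Pi; case: ifPn => Pi'.
- exact: s2.
- by case: (h i (S i) Pi (s1 _ Pi)) => _; apply; apply: hin.
- move=> e; symmetry; case: (h i' (S i') Pi' (s1 _ Pi')) => _; apply=> //.
  exact: hin.
- by apply: f2; apply: hin.
Qed.

Lemma patch_conn t t' D P F S T : P \subset D -> IT t (D :\: P) F ->
  (forall i x, i \in P -> t' i x -> t i x /\
     forall e, e \in D :\: P -> x.1 = (F e).1 -> x = F e) ->
  connect (reconf t' P) S T -> connect (reconf t D) (patch F P S) (patch F P T).
Proof.
move=> PD iF h; apply: (connect_inv (Q := fun T => connect _ _ (patch F P T))).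
  move=> S1 S2 c /reconfP[i1 i2 h3]; apply: connect_trans c _; apply: connect1.
  apply/reconfP; split; try exact: patch_IT iF h _.
  case/ITP: i1 => s1 _; case/ITP: i2 => s2 _; case/ITP: (iF) => _ f2.
  have hin i : i \in D -> i \notin P -> i \in D :\: P by move=> *; apply/setDP.
  move=> i i' Di Di'; rewrite !ffunE; case: ifPn => Pi; case: ifPn => Pi'.
  - exact: h3.
  - by case: (h i (S1 i) Pi (s1 _ Pi)) => _; apply; apply: hin.
  - move=> e; symmetry; case: (h i' (S2 i') Pi' (s2 _ Pi')) => _; apply=> //.
    exact: hin.
  - by apply: f2; apply: hin.
exact: connect0.
Qed.

Definition hop t D M : rel {ffun I -> J * bool} :=
  [rel S T : {ffun I -> J * bool} | [exists i in M, exists x,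
     [&& t i x, [forall i' in D, (S i').1 != x.1] & T == upd S i x]]].

Definition sole D M S :=
  forall i i', i \in M -> i' \in D -> (S i').1 = (S i).1 -> i' = i.

(* Moving a block that is alone on its component to a free component moves the
   free place the other way; these are the components that can be freed so. *)
Definition freeable t D M S : {set J} :=
  [set j | [exists T : {ffun I -> J * bool}, connect (hop t D M) S T && [forall i in D, (T i).1 != j]]].

Lemma hopP t D M S T :
  reflect (exists i x, [/\ i \in M, t i x,
             forall i', i' \in D -> (S i').1 <> x.1 & T = upd S i x])
          (hop t D M S T).
Proof.
apply: (iffP exists_inP) => [[i Mi /existsP[x /and3P[tx /forall_inP h /eqP->]]]|].
  by exists i, x; split=> // i' Di'; apply/eqP; apply: h.
move=> [i [x [Mi tx h ->]]]; exists i => //; apply/existsP; exists x.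
by rewrite tx eqxx andbT; apply/forall_inP=> i' Di'; apply/eqP; apply: h.
Qed.

Lemma freeableP t D M S j :
  reflect (exists T, connect (hop t D M) S T /\ forall i, i \in D -> (T i).1 <> j)
          (j \in freeable t D M S).
Proof.
rewrite inE; apply: (iffP existsP) => -[T].
  by move=> /andP[c /forall_inP h]; exists T; split=> // i Di; apply/eqP/h.
by move=> [c h]; exists T; rewrite c; apply/forall_inP=> i Di; apply/eqP; apply: h.
Qed.

Section Holes.

Variables (t : I -> J * bool -> bool) (D M : {set I}).
Hypothesis MD : M \subset D.

Lemma hop_pres S T : IT t D S -> sole D M S -> hop t D M S T ->
  [/\ reconf t D S T, sole D M T & forall i, i \notin M -> T i = S i].
Proof.
move=> iS soS /hopP[i [x [Mi tx h ->]]]; split.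
- by apply: reconf_upd => // i' Di' e; case: (h i' Di').
- move=> k k' Mk Dk'; rewrite !ffunE; case: eqP => [->|_]; case: eqP => [->|_] //.
  + by move=> e; case: (h k); rewrite ?e // (subsetP MD).
  + by move=> e; case: (h k').
  + exact: soS.
- by move=> k Mk; rewrite updN //; apply: contraNneq Mk => ->.
Qed.

Lemma reachP S T : IT t D S -> sole D M S -> connect (hop t D M) S T ->
  [/\ connect (reconf t D) S T, IT t D T, sole D M T &
      forall i, i \notin M -> T i = S i].
Proof.
move=> iS soS; apply: (connect_inv (Q := fun T => [/\ connect (reconf t D) S T,
  IT t D T, sole D M T & forall i, i \notin M -> T i = S i])); last by split.
move=> S1 S2 [c1 i1 so1 f1] h; have [m so f] := hop_pres i1 so1 h.
split=> //; first exact: connect_trans c1 (connect1 m).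
  by case/reconfP: m.
by move=> i Mi; rewrite f ?f1.
Qed.

Variable S : {ffun I -> J * bool}.
Hypotheses (iS : IT t D S) (soS : sole D M S).
Let H := freeable t D M S.

Lemma freeable_free j : (forall i, i \in D -> (S i).1 <> j) -> j \in H.
Proof. by move=> h; apply/freeableP; exists S; split=> //; apply: connect0. Qed.

(** A hop goes from a component that thereby becomes free to one that was free, so both of its ends
    are freeable. *)
Lemma freeable_track T i : i \in D -> connect (hop t D M) S T ->
  T i = S i \/ ((S i).1 \in H /\ (T i).1 \in H).
Proof.
move=> Di.
pose Q T := connect (hop t D M) S T /\ (T i = S i \/ ((S i).1 \in H /\ (T i).1 \in H)).
suff: connect (hop t D M) S T -> Q T by move=> h /h[].
apply: (connect_inv (Q := Q)); last by split=> //; left.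
move=> S1 S2 [c1 h1] h12; have [_ i1 so1 _] := reachP iS soS c1.
have c2 := connect_trans c1 (connect1 h12); split=> //.
case/hopP: h12 => k [x [Mk tx h e2]]; rewrite e2 ffunE.
case: eqP => [ik|_] //; right.
have xH : x.1 \in H by apply/freeableP; exists S1.
split=> //; case: h1 => [e1|[]//].
apply/freeableP; exists S2; split=> // i' Di'.
rewrite e2 ffunE; case: eqP => [_|i'k] e; first by case: (h i); rewrite // e1 e.
apply: i'k; apply: (so1 _ _ Mk Di'); rewrite e -ik e1 //.
Qed.

(** Bring the free place to j; if i has not moved meanwhile, let it hop to j, which frees its own
    component. *)
Lemma freeable_closed i j b : i \in M -> t i (j, b) -> j \in H -> (S i).1 \in H.
Proof.
move=> Mi tij /freeableP[T [c h]]; have Di := subsetP MD _ Mi.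
have [_ iT soT _] := reachP iS soS c.
case: (freeable_track Di c) => [e|[]//].
apply/freeableP; exists (upd T i (j, b)); split.
  apply: connect_trans c (connect1 _); apply/hopP; exists i, (j, b).
  by split.
move=> i' Di'; rewrite ffunE; case: eqP => [_ /= ej|ne e'].
  by case: (h i) => //; rewrite e -ej.
by case: ne; apply: (soT _ _ Mi Di'); rewrite e' e.
Qed.

Lemma freeable_movable i : i \in D -> (S i).1 \in H -> i \in M.
Proof.
move=> Di /freeableP[T [c h]]; apply/negPn/negP => Mi.
by have [_ _ _ f] := reachP iS soS c; case: (h i Di); rewrite f.
Qed.

Lemma augment X :
  (forall B : {set I}, B \subset M -> #|used_comps S (D :\: B)| < #|touched t ((D :\: B) :|: X)|) ->
  exists i T x, [/\ i \in X :|: (D :\: M), connect (hop t D M) S T, t i x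
                  & forall i', i' \in D -> (T i').1 <> x.1].
Proof.
pose B := [set i in M | (S i).1 \in H] => /(_ B).
have BM : B \subset M by apply/subsetP=> i; rewrite inE => /andP[].
move=> /(_ BM) lt.
have [j]: exists j, j \in touched t ((D :\: B) :|: X) /\ j \notin used_comps S (D :\: B).
  have: ~~ (touched t ((D :\: B) :|: X) \subset used_comps S (D :\: B)).
    by apply/negP=> /subset_leq_card; rewrite leqNgt lt.
  by case/subsetPn=> j; exists j.
case=> /touchedP[i [b [iX tij]]] jn.
have jH : j \in H.
  case: (boolP (j \in used_comps S D)) => [/imsetP[k Dk ek]|nj].
    apply: contraR jn => jH; apply/imsetP; exists k => //.
    by rewrite in_setD Dk andbT /B in_set -ek (negPf jH) andbF.
  by apply: freeable_free => k Dk e; case/negP: nj; apply/imsetP; exists k.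
have iXM : i \in X :|: (D :\: M).
  case/setUP: iX => iX; apply/setUP; [right|by left].
  case/setDP: iX => Di iB; apply/setDP; split=> //.
  apply: contraNN iB => Mi; rewrite in_set Mi; exact: freeable_closed Mi tij jH.
by case/freeableP: jH => T [c h]; exists i, T, (j, b).
Qed.

End Holes.

(** * Transversals with distinct components *)

Definition distinct_on D S := {in D &, injective (fun i => (S i).1)}.

Lemma distinct_sub D P S : P \subset D -> distinct_on D S -> distinct_on P S.
Proof. by move=> /subsetP PD h i i' /PD Di /PD; apply: h. Qed.

(** Hall's theorem, one block at a time: all blocks placed so far are movable, and the new block i
    plays the role of X in [augment]. *)
Lemma hall t D S0 :
  (forall Q, Q \subset D -> #|Q| <= #|touched t Q|) -> exists S, IT t D S /\ distinct_on D S.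
Proof.
elim: {D}#|D| {-2}D (leqnn #|D|) => [|n IH] D.
  rewrite leqn0 cards_eq0 => /eqP-> _; exists S0; split; last by move=> i; rewrite inE.
  by apply/ITP; split=> i; rewrite inE.
move=> Dn hD; case: (set_0Vmem D) => [D0|[i Di]].
  by apply: IH => //; rewrite D0 cards0.
have D1n : #|D :\ i| <= n by move: Dn; rewrite (cardsD1 i D) Di.
have sD : D :\ i \subset D by exact: subD1set.
case: (IH (D :\ i) D1n) => [Q QD|S [iS inS]].
  by apply: hD; apply: subset_trans QD sD.
have soS : sole (D :\ i) (D :\ i) S by move=> k k' Dk Dk'; apply: inS.
have [B BD|k [T [x [kD c tx h]]]] := augment (subxx _) iS soS (X := [set i]).
  apply: leq_trans (hD _ _).
    rewrite setUC cardsU1 !inE eqxx andbF add1n ltnS; exact: leq_imset_card.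
  apply/subsetP=> k; rewrite !inE.
  by case/orP=> [/and3P[]|/eqP->].
have ek : k = i by move: kD; rewrite setDv setU0 => /set1P.
subst k; have [_ /ITP[T1 T2] soT _] := reachP (subxx _) iS soS c.
have hin k : k \in D -> k != i -> k \in D :\ i by move=> *; rewrite !inE; apply/andP.
exists (upd T i x); split.
  apply/ITP; split=> [k Dk|k k' Dk Dk']; rewrite !ffunE.
    by case: eqP => [->|/eqP ne] //; apply: T1; apply: hin.
  case: eqP => [_|/eqP ne]; case: eqP => [_|/eqP ne'] //.
  - by move=> e; case: (h k'); rewrite ?e //; apply: hin.
  - by move=> e; case: (h k); rewrite ?e //; apply: hin.
  - by apply: T2; apply: hin.
move=> k k' Dk Dk' /=; rewrite !ffunE.
case: eqP => [->|/eqP ne]; case: eqP => [->|/eqP ne'] //.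
- by move=> e; case: (h k'); rewrite ?e //; apply: hin.
- by move=> e; case: (h k); rewrite ?e //; apply: hin.
- by move=> e; apply: soT; rewrite ?hin //; apply: hin.
Qed.

(** Blocks that share a component stand still and all others are movable. Sharing makes the used
    components fewer than the blocks, so under Hall's condition [augment] frees a component for a
    sharing block; once alone there, it leaves the set [Z] of sharing blocks. *)
Lemma conn_distinct t D S : IT t D S ->
  (forall Q, Q \subset D -> #|Q| <= #|touched t Q|) ->
  exists T, [/\ connect (reconf t D) S T, IT t D T & distinct_on D T].
Proof.
pose Z S := [set i in D | [exists k in D, (k != i) && ((S k).1 == (S i).1)]].
have ZP S1 i : reflect (i \in D /\ exists k, [/\ k \in D, k <> i & (S1 k).1 = (S1 i).1])
                       (i \in Z S1).
  rewrite inE; apply: (iffP andP) => -[Di].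
    by case/exists_inP=> k Dk /andP[/eqP ne /eqP e]; split=> //; exists k.
  case=> k [Dk ne e]; split=> //; apply/exists_inP; exists k => //.
  by rewrite e eqxx andbT; apply/eqP.
move=> + hD; elim: {S}#|Z S| {-2}S (leqnn #|Z S|) => [|n IH] S.
  rewrite leqn0 cards_eq0 => /eqP Z0 iS; exists S; split=> // i i' Di Di' /= e.
  apply/eqP/negPn/negP => /eqP ne; have : i' \in Z S by apply/ZP; split=> //; exists i.
  by rewrite Z0 inE.
move=> Zn iS; have MD : D :\: Z S \subset D by exact: subsetDl.
have soS : sole D (D :\: Z S) S.
  move=> i i' /setDP[Di Zi] Di' e; apply/eqP/negPn/negP => /eqP ne.
  by case/negP: Zi; apply/ZP; split=> //; exists i'.
case: (set_0Vmem (Z S)) => [Z0|[z Zz]]; first by apply: IH; rewrite ?Z0 ?cards0.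
have [B BD|i [T [x [iD c tx h]]]] := augment MD iS soS (X := set0).
  rewrite setU0; apply: leq_trans (hD _ (subsetDl _ _)).
  rewrite ltn_neqAle leq_imset_card andbT; apply/negP=> /imset_injP inS.
  case/ZP: (Zz) => Dz [k [Dk ne e]].
  have notB i : i \in D -> i \in Z S -> i \in D :\: B.
    move=> Di Zi; apply/setDP; split=> //; apply/negP=> /(subsetP BD).
    by rewrite inE Zi.
  case: (ne); apply: inS => //; apply: notB => //.
  by apply/ZP; split=> //; exists z; split=> // /esym.
have Zi : i \in Z S.
  case/setUP: iD => [|/setDP[Di]]; first by rewrite inE.
  by rewrite in_setD Di andbT negbK.
have Di : i \in D by case/ZP: Zi.
have [cT iT soT fT] := reachP MD iS soS c.
have mT : reconf t D T (upd T i x) by apply: reconf_upd => // k Dk e; case: (h k).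
case: (IH (upd T i x)) => [||T' [cT' iT' inT']]; last first.
- exists T'; split=> //; apply: connect_trans cT _.
  exact: connect_trans (connect1 mT) cT'.
- by case/reconfP: mT.
rewrite -ltnS; apply: leq_trans Zn; apply: proper_card; apply/properP; split.
  apply/subsetP=> k /ZP[Dk [k' [Dk' ne]]]; rewrite !ffunE.
  case: (k' =P i) => [ek'|_]; case: (k =P i) => [ek|_] e.
  - by case: ne; rewrite ek' ek.
  - by case: (h k).
  - by case: (h k').
  apply/negPn/negP=> Zk; have Mk : k \in D :\: Z S by apply/setDP.
  by apply: ne; apply: soT.
exists i => //; apply/negP=> /ZP[_ [k [Dk ne]]]; rewrite !ffunE eqxx.
by case: eqP => // _; apply: h.
Qed.

End Reconfiguration.

(** * Freeing a component when one block has no private side *)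

Section Release.

Variables I J : finType.
Implicit Types (t : I -> J * bool -> bool) (D E P Q M R X : {set I}) (C : {set J})
  (S T F : {ffun I -> J * bool}) (x y : J * bool).

(** A component without a vertex in the blocks of R is confined to every Q, even the empty one. The
    later hypothesis [confined t D C set0 = set0] therefore says that every component of C is
    touched. *)
Definition confined t R C Q : {set J} :=
  [set j in C | [forall i in R, forall b, t i (j, b) ==> (i \in Q)]].

Lemma confinedP t R C Q j :
  reflect (j \in C /\ forall i b, i \in R -> t i (j, b) -> i \in Q)
          (j \in confined t R C Q).
Proof.
rewrite inE; apply: (iffP andP) => -[Cj h]; split=> //.
  move=> i b Ri; exact: (implyP (forallP (implyP (forallP h i) Ri) b)).
apply/forall_inP=> i Ri; apply/forallP=> b; apply/implyP; exact: h.
Qed.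

Variables (t : I -> J * bool -> bool) (P O : {set I}) (C : {set J}) (k : I).
Hypotheses (tC : forall i x, t i x -> x.1 \in C) (kP : k \in P) (PC : #|P| = #|C|).
Hypothesis noprivate :
  forall x, t k x -> exists w, [/\ w \in P :|: O, w <> k & t w x].
Hypothesis surplus : forall Q, Q \subset P -> Q != set0 -> Q != P ->
  #|confined t (P :|: O) C Q| < #|Q|.
Variable S0 : {ffun I -> J * bool}.

Definition reached S :=
  [/\ connect (reconf t P) S0 S, IT t P S & distinct_on (P :\ k) S].

(** The block k is exempt from the freshness condition: it may already stand on the very side x that
    o takes. This is why distinctness is kept only on P without k. *)
Definition placeable := exists S o x,
  [/\ reached S, o \in O, t o x, forall i, i \in P :\ k -> (S i).1 <> x.1
    & (S k).1 = x.1 -> S k = x].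

Definition evacuable := forall j, j \in C ->
  exists S, reached S /\ forall i, i \in P -> (S i).1 <> j.

(* While k shares a side with w, one component of C is free, and the free place
   travels through [H S w] as the blocks of [Y S w] move. *)
Definition riding S w := [/\ reached S, w \in P :\ k & S w = S k].

Let Mv w := P :\ k :\ w.
Let H S w := freeable t P (Mv w) S :&: C.
Let Y S w := w |: [set i in Mv w | (S i).1 \in H S w].

Lemma MvP w i : reflect [/\ i \in P, i <> k & i <> w] (i \in Mv w).
Proof.
rewrite !inE; apply: (iffP and3P) => -[].
  by move=> /eqP ? /eqP ? ?.
by move=> ? /eqP ? /eqP.
Qed.

Lemma Mv_sub w : Mv w \subset P.
Proof. by apply/subsetP=> i /MvP[]. Qed.

Lemma PkP i : reflect (i \in P /\ i <> k) (i \in P :\ k).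
Proof. by rewrite !inE andbC; apply: (iffP andP) => -[? /eqP]. Qed.

Lemma reached_C S i : reached S -> i \in P -> (S i).1 \in C.
Proof. by case=> _ /ITP[h _] _ /h /tC. Qed.

(** If k is alone on its component, some other block w touches its side, as that side is not
    private: w joins k there, or is placed at once when it belongs to [O]. *)
Lemma ride S : reached S ->
  placeable \/ exists S' w, riding S' w /\ (S' = S \/
     [/\ S' = upd S w (S k), t w (S k) & forall i, i \in P :\ k -> (S i).1 <> (S k).1]).
Proof.
move=> rS; case: (rS) => cS iS inS; case/ITP: (iS) => h1 h2.
case: (boolP [exists w in P :\ k, (S w).1 == (S k).1]).
  case/exists_inP=> w wP /eqP e; right; exists S, w; split; last by left.
  by split=> //; apply: h2 => //; case/PkP: wP.
move=> /exists_inPn nw.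
have {}nw i : i \in P :\ k -> (S i).1 <> (S k).1 by move=> /nw/eqP.
have [w [wPO wk tw]] := noprivate (h1 _ kP).
case: (boolP (w \in O)) => [wO|wO].
  by left; exists S, w, (S k).
have wP : w \in P by case/setUP: wPO wO => // ->.
right; exists (upd S w (S k)), w; split; last by right.
have m : reconf t P S (upd S w (S k)) by apply: reconf_upd => // i Pi; apply: h2.
have kw : k != w by apply/eqP=> e; apply: wk.
split; last by rewrite updE updN.
  split; first exact: connect_trans cS (connect1 m).
    by case/reconfP: m.
  move=> i i' Di Di' /=; rewrite !ffunE; case: eqP => [->|_]; case: eqP => [->|_] // e.
  - by case: (nw i').
  - by case: (nw i).
  - exact: inS.
by apply/PkP.
Qed.

Lemma riding_sole S w : riding S w -> sole P (Mv w) S.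
Proof.
case=> -[_ _ inS] wP e i i' /MvP[Pi ik iw] Pi' e'.
case: (i' =P k) => [ek|ne]; last by apply: inS => //; apply/PkP.
case: iw; apply: inS => //=; first by apply/PkP.
by rewrite e -e' ek.
Qed.

Lemma riding_reach S w T : riding S w -> connect (hop t P (Mv w)) S T ->
  riding T w /\ sole P (Mv w) T.
Proof.
move=> rS c; have soS := riding_sole rS; case: rS => -[cS iS inS] wP e.
have [cT iT soT fT] := reachP (Mv_sub w) iS soS c; split=> //; split=> //.
  split=> //; first exact: connect_trans cS cT.
  move=> i i' /PkP[Pi ik] /PkP[Pi' ik'] /= e'.
  case: (i =P w) => [iw|iw]; last by symmetry; apply: soT => //; apply/MvP.
  case: (i' =P w) => [iw'|iw']; first by rewrite iw iw'.
  by apply: soT => //; apply/MvP.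
rewrite !fT //; by apply/negP=> /MvP[].
Qed.

Lemma H_free S w j : riding S w -> j \in H S w ->
  exists T, [/\ connect (hop t P (Mv w)) S T, riding T w
             & forall i, i \in P -> (T i).1 <> j].
Proof.
move=> rS /setIP[/freeableP[T [c h]] _]; exists T; split=> //.
by case: (riding_reach rS c).
Qed.

(** A block of [O] touching [H] can be placed, and a movable block of P touching [H] has its own
    component in [H]; so otherwise only k and [Y] touch [H]. The blocks of [Y] other than w use
    distinct components of [H], and the currently free component, also in [H], makes up for w. *)
Lemma riding_facts S w : riding S w -> placeable \/
  (forall i j b, i \in P :|: O -> t i (j, b) -> j \in H S w -> i \in k |: Y S w)
  /\ #|Y S w| <= #|H S w|.
Proof.
move=> rS; have soS := riding_sole rS; have [[cS iS inS] wP e] := rS.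
case: (boolP [exists o in O, exists x, t o x && (x.1 \in H S w)]).
  case/exists_inP=> o Oo /existsP[x /andP[tx /(H_free rS)[T [c [rT _ _] h]]]].
  left; exists T, o, x; split=> //; last by move=> e'; case: (h k).
  by move=> i /PkP[Pi _]; apply: h.
move=> /exists_inPn nO; right; split.
  move=> i j b /setUP[Pi|Oi] tij jH; last first.
    by case/negP: (nO i Oi); apply/existsP; exists (j, b); rewrite tij.
  rewrite in_setU1; case: (i =P k) => //= ik; rewrite in_setU1; case: (i =P w) => //= iw.
  have Mi : i \in Mv w by apply/MvP.
  rewrite in_set Mi; apply/setIP; split; last exact: reached_C (And3 cS iS inS) Pi.
  by case/setIP: jH => jH _; apply: freeable_closed Mi tij jH => //; apply: Mv_sub.
(* As w and k share a component, S uses fewer than |P| = |C| components. *)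
have [h hC hn]: exists2 h, h \in C & h \notin used_comps S P.
  have: ~~ (C \subset used_comps S P).
    apply/negP=> /subset_leq_card; rewrite -PC leqNgt => /negP; apply.
    rewrite ltn_neqAle leq_imset_card andbT; apply/negP=> /imset_injP inP.
    by case/PkP: wP => wP; case; apply: inP => //; rewrite e.
  by case/subsetPn=> h; exists h.
pose B := [set i in Mv w | (S i).1 \in H S w].
have wB : w \notin B by rewrite in_set; apply/andP=> -[/MvP[]].
rewrite /Y cardsU1 wB -/B.
have <- : #|used_comps S B| = #|B|.
  apply: card_in_imset => i i' /setIdP[Mi _] /setIdP[Mi' _] /= e'.
  by apply/esym/(soS i i' Mi _ (esym e')); apply: (subsetP (Mv_sub w) _ Mi').
have hB : h \notin used_comps S B.
  apply: contraNN hn => /imsetP[i /setIdP[/MvP[Pi _ _] _] ->].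
  by apply/imsetP; exists i.
have := cardsU1 h (used_comps S B); rewrite hB => <-.
apply/subset_leq_card/subsetP=> j /setU1P[->|/imsetP[i /setIdP[_ iH] ->]] //.
  apply/setIP; split=> //; apply: freeable_free => i Pi e'.
  by case/negP: hn; apply/imsetP; exists i.
Qed.

(* The blocks other than k that touch H are in Y, and |H| >= |Y|; by surplus k
   touches H, so it can move into H, next to some w1 in Y, which yields H1 and Y1.
   If the old place of w is not in H1, then H1 is a proper part of H and we recurse;
   otherwise only Y, Y1 and k touch the at least |k + Y + Y1| components of H and
   H1, so by surplus these are all the components. *)
Lemma release_riding S w : riding S w -> placeable \/ evacuable.
Proof.
elim: {S w}#|H S w| {-2}S {-2}w (leqnn #|H S w|) => [|n IH] S w Hn rS.
  case: (riding_facts rS) => [|[_]]; first by left.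
  by rewrite (leqn0 _) in Hn; rewrite (eqP Hn) leqn0 cards_eq0 => /eqP e;
     have: w \in Y S w by [rewrite setU11]; rewrite e inE.
case: (riding_facts rS) => [|[HY cY]]; first by left.
have soS := riding_sole rS; have [[cS iS inS] wP ew] := rS.
have kY : k \notin Y S w.
  rewrite !inE; case/PkP: wP => _ wk; case: (k =P w) => [/esym|] //= _.
  by rewrite eqxx !(andbF, andFb).
have wY : w \in Y S w by rewrite setU11.
have YP : Y S w \subset P.
  by apply/subsetP=> i /setU1P[->|/setIdP[/MvP[]]] //; case/PkP: wP.
have [x1 tk1 x1H]: exists2 x, t k x & x.1 \in H S w.
  case: (boolP [exists x, t k x && (x.1 \in H S w)]) => [/existsP[x /andP[]]|].
    by exists x.
  move=> /existsPn nk; exfalso.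
  have: #|confined t (P :|: O) C (Y S w)| < #|Y S w|.
    apply: surplus => //; first by apply/set0Pn; exists w.
    by apply: contraNneq kY => ->.
  rewrite ltnNge => /negP; apply; apply: leq_trans cY _.
  apply/subset_leq_card/subsetP=> j jH; apply/confinedP; split; first by case/setIP: jH.
  move=> i b PO tij; case/setU1P: (HY _ _ _ PO tij jH) => // ik.
  by move: (nk (j, b)); rewrite -ik tij jH.
have [S1 [c1 r1 f1]] := H_free rS x1H.
have [_ so1] := riding_reach rS c1.
have [[cS1 iS1 inS1] _ ew1] := r1.
pose S1' := upd S1 k x1.
have m1 : reconf t P S1 S1' by apply: reconf_upd => // i Pi e; case: (f1 i).
have upk i : i \in P :\ k -> S1' i = S1 i.
  by move=> /PkP[_ ik]; rewrite updN //; apply/eqP.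
have r1' : reached S1'.
  split; first exact: connect_trans cS1 (connect1 m1).
    by case/reconfP: m1.
  by move=> i i' Di Di' /=; rewrite !upk //; apply: inS1.
case: (ride r1') => [|[S2 [w1 [r2 hS2]]]]; first by left.
have [rr2 w1P ew2] := r2.
have S1k : S1' k = x1 by rewrite updE.
have [eS2 tw1]: S2 = upd S1' w1 x1 /\ t w1 x1.
  case: hS2 => [e|[-> tw _]]; last by rewrite -S1k.
  case: (f1 w1); first by case/PkP: w1P.
  by rewrite -upk // -S1k -e ew2.
have w1k : w1 <> k by case/PkP: w1P.
have w1Y : w1 \in Y S w.
  have: w1 \in k |: Y S w.
    by apply: (HY _ x1.1 x1.2) => //; [rewrite inE; case/PkP: w1P => ->|case: (x1) tw1].
  by case/setU1P.
case: (riding_facts r2) => [|[HY1 cY1]]; first by left.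
have so2 := riding_sole r2; have [cS2 iS2 inS2] := rr2.
have S2E i : i \in Mv w1 -> S2 i = S1 i.
  move=> /MvP[Pi ik iw]; rewrite eS2 updN; last exact/eqP.
  by apply: upk; apply/PkP.
have S2k : S2 k = x1.
  by rewrite eS2 updN; [rewrite S1k|apply/eqP=> /esym].
have S2w1 : S2 w1 = x1 by rewrite ew2.
have BH i : i \in Y S w -> i != w -> (S1 i).1 \in H S w.
  move=> /setU1P[->|/setIdP[/MvP[Pi _ _] /[dup] iH /setIP[iF _]]].
    by rewrite eqxx.
  move=> _.
  case: (freeable_track (Mv_sub w) iS soS Pi c1) => [->|[_ h]] //.
  apply/setIP; split=> //; exact: reached_C (And3 cS1 iS1 inS1) Pi.
have S1w : S1 w = S w.
  by have [_ _ _ ->] := reachP (Mv_sub w) iS soS c1 => //; apply/negP=> /MvP[].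
have w1H1 : (S1 w1).1 \in H S2 w1.
  apply/setIP; split; last first.
    by apply: reached_C (And3 cS1 iS1 inS1) _; case/PkP: w1P.
  apply: freeable_free => i Pi.
  case: (i =P k) => [->|ik].
    by rewrite S2k => /esym; apply: f1; case/PkP: w1P.
  case: (i =P w1) => [->|iw].
    by rewrite S2w1 => /esym; apply: f1; case/PkP: w1P.
  rewrite S2E; last by apply/MvP.
  by move=> e; apply: iw; apply: inS1 => //; apply/PkP.
case: (boolP ((S w).1 \in H S2 w1)) => [wH1|wH1].
  right; pose Q := k |: (Y S w :|: Y S2 w1).
  have QP : Q \subset P.
    apply/subsetP=> i /setU1P[->|/setUP[/(subsetP YP)|/setU1P[->|/setIdP[/MvP[]]]]] //.
    by case/PkP: w1P.
  have cardQ : #|Q| <= #|H S w :|: H S2 w1|.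
    (* In [S1'] the block k has arrived at [x1] and [w1] has not joined it yet, so all blocks of P
       stand on distinct components. *)
    have <- : #|used_comps S1' Q| = #|Q|.
      have free i : i \in P -> i <> k -> (S1' i).1 <> (S1' k).1.
        by move=> Pi ik; rewrite S1k upk; [apply: f1|apply/PkP].
      apply: card_in_imset => i i' /(subsetP QP) Pi /(subsetP QP) Pi' /= e.
      case: (i =P k) => [ik|ik]; case: (i' =P k) => [ik'|ik'].
      - by rewrite ik ik'.
      - by case: (free i') => //; rewrite -e ik.
      - by case: (free i) => //; rewrite e ik'.
      by case: r1' => _ _; apply=> //; apply/PkP.
    apply/subset_leq_card/subsetP=> j /imsetP[i iQ ->].
    case: (i =P k) => [->|ik]; first by rewrite S1k in_setU x1H.
    have Pi := subsetP QP _ iQ.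
    rewrite upk; last by apply/PkP.
    case: (i =P w) => [->|/eqP iw]; first by rewrite S1w in_setU wH1 orbT.
    case: (i =P w1) => [->|iw1]; first by rewrite in_setU w1H1 orbT.
    case/setU1P: iQ => // /setUP[iY|/setU1P[//|/setIdP[Mi]]].
      by rewrite in_setU BH.
    by rewrite S2E // in_setU orbC => ->.
  have Hcont : H S w :|: H S2 w1 \subset confined t (P :|: O) C Q.
    apply/subsetP=> j jH; apply/confinedP; split; first by case/setUP: jH => /setIP[].
    move=> i b PO tij; apply/setU1P; case/setUP: jH => jH.
      case/setU1P: (HY _ _ _ PO tij jH) => h; [by left|right].
      by apply/setUP; left.
    case/setU1P: (HY1 _ _ _ PO tij jH) => h; [by left|right].
    by apply/setUP; right.
  have QeP : Q = P.
    have Q0 : Q != set0 by apply/set0Pn; exists k; rewrite setU11.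
    apply/eqP/negPn/negP => QnP; have := surplus QP Q0 QnP.
    by rewrite ltnNge (leq_trans cardQ (subset_leq_card Hcont)).
  have HC : H S w :|: H S2 w1 = C.
    apply/eqP; rewrite eqEcard -PC -[in X in X <= _]QeP cardQ andbT.
    by apply/subsetP=> j /setUP[]/setIP[].
  move=> j; rewrite -HC => /setUP[/(H_free rS)|/(H_free r2)] [T [_ [rT _ _] h]];
    by exists T.
apply: (IH S2 w1) => //; rewrite -ltnS; apply: leq_trans Hn.
apply/proper_card/properP; split; last first.
  exists x1.1 => //; apply/negP=> /setIP[h _].
  have: k \in Mv w1 by apply: (freeable_movable (Mv_sub w1) iS2 so2); rewrite ?S2k.
  by case/MvP.
apply/subsetP=> j /[dup] jH1 /setIP[/freeableP[T [cT hT]] Cj].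
(* Along the hops from [S2] the block w stays put: a hop of w would put its component into
   [H S2 w1], against [wH1]. Then free places and the other blocks of [Y S w] never leave [H S w],
   so [H S2 w1] is contained in it. *)
pose Inv T := [/\ connect (hop t P (Mv w1)) S2 T,
  forall j, j \in C -> (forall i, i \in P -> (T i).1 <> j) -> j \in H S w,
  forall i, i \in Y S w -> i != w -> (T i).1 \in H S w & T w = S w].
have w1w : w <> w1.
  by move=> e; case/negP: wH1; rewrite -S1w e.
suff: Inv T by case=> _ h _ _; apply: h.
apply: connect_inv cT => [T1 T2 [cT1 free BT wT] h12|]; last first.
  split; first exact: connect0.
  - move=> j' Cj' h; case: (j' =P (S1 w1).1) => [->|ne].
      by apply: BH => //; apply/eqP=> e; case: w1w.
    apply/setIP; split=> //; apply/freeableP; exists S1; split=> // i Pi e.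
    case: (i =P k) => [ik|ik].
      case/PkP: (wP) => Pw wk; case: (h w) => //.
      by rewrite S2E; [rewrite ew1 -ik|apply/MvP].
    case: (i =P w1) => [iw|iw]; first by case: ne; rewrite -e iw.
    by case: (h i) => //; rewrite S2E //; apply/MvP.
  - move=> i iY iw; case: (i =P w1) => [->|iw1]; first by rewrite S2w1.
    rewrite S2E; first exact: BH.
    apply/MvP; split=> //; first exact: (subsetP YP).
    by move=> ik; case/negP: kY; rewrite -ik.
  - rewrite S2E ?S1w //; apply/MvP; by case/PkP: wP.
have [_ iT1 soT1 _] := reachP (Mv_sub w1) iS2 so2 cT1.
have cT2 := connect_trans cT1 (connect1 h12).
case/hopP: h12 => i [x [Mi tix hx eT2]]; case/MvP: (Mi) => Pi ik iw1.
have xH : x.1 \in H S w by apply: free => //; apply: tC tix.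
have iY : i \in Y S w.
  have: i \in k |: Y S w.
    by apply: (HY _ x.1 x.2) => //; [rewrite inE Pi|case: (x) tix].
  by case/setU1P.
have iw : i <> w.
  move=> iw; case/negP: wH1; rewrite -wT -iw; apply/setIP; split.
    apply/freeableP; exists T2; split=> // i' Pi'; rewrite eT2 ffunE.
    case: (i' =P i) => [_ e|ne e]; first by case: (hx i).
    by case: ne; apply: soT1.
  by apply: tC (_ : t i _); case/ITP: iT1 => h _; apply: h.
split=> //.
- move=> j' Cj' h; case: (j' =P (T1 i).1) => [->|ne].
    by apply: BT => //; apply/eqP.
  apply: free => // i' Pi' e; case: (i' =P i) => [ii|ii]; first by case: ne; rewrite -e ii.
  by case: (h i') => //; rewrite eT2 updN //; apply/eqP.
- move=> i' i'Y i'w; rewrite eT2 ffunE; case: eqP => // _; exact: BT.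
- by rewrite eT2 updN //; apply/eqP=> /esym.
Qed.

Lemma release : IT t P S0 -> distinct_on (P :\ k) S0 -> placeable \/ evacuable.
Proof.
move=> i0 in0; have r0 : reached S0 by split.
case: (ride r0) => [|[S [w [rS _]]]]; first by left.
exact: release_riding rS.
Qed.

End Release.

(** * Connectivity from Hall-type surplus *)

Section Connectivity.

Variables I J : finType.
Implicit Types (t : I -> J * bool -> bool) (D E P Q M R X : {set I}) (C : {set J})
  (S T F U : {ffun I -> J * bool}) (x y : J * bool).

Definition diff D S T := [set i in D | S i != T i].

Definition avoiding t C : I -> J * bool -> bool := fun i x => t i x && (x.1 \notin C).

Lemma diffP D S T i : reflect (i \in D /\ S i <> T i) (i \in diff D S T).
Proof. by rewrite inE; apply: (iffP andP) => -[? /eqP]. Qed.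

Lemma diff_eq D S T i : i \in D -> i \notin diff D S T -> S i = T i.
Proof. by move=> Di; apply: contraNeq => /eqP ne; apply/diffP. Qed.

Lemma diff0_conn t D S T : IT t D S -> diff D S T = set0 -> connect (reconf t D) S T.
Proof.
move=> iS E0; apply/connect1/reconf_eq => // i Di; apply: diff_eq Di _.
by rewrite E0 inE.
Qed.

(** A block of S already on the component of [T d] is outside the disagreement set, hence stands
    where T puts it, on the same side as [T d]. [D0] will be D in [conn_surplus] and D without k in
    [conn_core]. *)
Lemma agree_step t D D0 S T d : D0 \subset D -> IT t D S -> IT t D T ->
  d \in D -> (T d).1 \notin used_comps S (diff D S T) -> distinct_on D0 S -> distinct_on D0 T ->
  [/\ reconf t D S (upd S d (T d)), distinct_on D0 (upd S d (T d)) &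
      diff D (upd S d (T d)) T \subset diff D S T :\ d].
Proof.
move=> D0D iS /ITP[T1 T2] Dd dn inS inT.
have out i : i \in D -> (S i).1 = (T d).1 -> S i = T i.
  move=> Di e; apply: diff_eq Di _; apply: contraNN dn => iE.
  by apply/imsetP; exists i.
split.
- apply: reconf_upd => //; first exact: T1.
  by move=> i Di e; rewrite out //; apply: T2 => //; rewrite -out.
- move=> i i' Di Di' /=; rewrite !ffunE.
  case: (i =P d) => [id|_]; case: (i' =P d) => [id'|_] e.
  + by rewrite id id'.
  + apply: inT => //=; rewrite id e out //; exact: (subsetP D0D).
  + apply: inT => //=; rewrite id' -e out //; exact: (subsetP D0D).
  + exact: inS.
- apply/subsetP=> i /diffP[Di]; rewrite ffunE in_setD1.
  by case: eqP => [->|_ ne] //=; apply/diffP.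
Qed.

(** The blocks of E stand still on the components C while the others rearrange themselves off C,
    until e can step to x. Applied with the same S and x to two transversals that agree on P and use
    the same components on E, it makes them agree at e too. *)
Lemma place t D D0 E C U S e x (P := D :\: E) :
  D0 \subset D -> E \subset D -> IT t D U -> used_comps U E = C ->
  (forall i, i \in P -> (U i).1 \notin C) -> distinct_on D0 U ->
  connect (reconf (avoiding t C) P) U S -> distinct_on (D0 :\: E) S ->
  e \in E -> t e x -> x.1 \notin C ->
  (forall i, i \in P -> (S i).1 = x.1 -> S i = x) ->
  (forall i, i \in D0 :\: E -> (S i).1 <> x.1) ->
  connect (reconf t D) U (upd (patch U P S) e x) /\ distinct_on D0 (upd (patch U P S) e x).
Proof.
move=> D0D ED iU UE UP inU cS inS eE tx xC comp fresh.
have PD : P \subset D by apply: subsetDl.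
have DPE : D :\: P = E by rewrite setDDr setDv set0U; apply/setIidPr.
have iUP : IT (avoiding t C) P U.
  case/ITP: (iU) => h1 h2; apply/ITP; split=> [i Pi|i i' Pi Pi'].
    by rewrite /avoiding h1 ?UP //; apply: (subsetP PD).
  by apply: h2; apply: (subsetP PD).
have hoff i y : i \in P -> avoiding t C i y -> t i y /\
    forall e', e' \in D :\: P -> y.1 = (U e').1 -> y = U e'.
  move=> Pi /andP[ty yC]; split=> // e'; rewrite DPE => e'E ey.
  by case/negP: yC; rewrite ey -UE; apply/imsetP; exists e'.
have iUE : IT t (D :\: P) U by apply: IT_sub iU; rewrite DPE.
have cU : connect (reconf t D) U (patch U P S).
  apply: connect_trans (patch_conn PD iUE hoff cS); apply/connect1/reconf_eq => //.
  by move=> i _; rewrite ffunE if_same.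
have iS := conn_IT iUP cS.
have iUS := conn_IT iU cU.
have SC i : i \in P -> (S i).1 \notin C.
  by case/ITP: iS => h _ Pi; case/andP: (h i Pi).
have notP i : i \in E -> (i \in P) = false by move=> iE; rewrite in_setD iE.
have EC i : i \in E -> (U i).1 \in C.
  by move=> iE; rewrite -UE; apply/imsetP; exists i.
have DPE' i : i \in D -> i \notin P -> i \in E.
  by move=> Di nP; rewrite -DPE in_setD nP.
have D0P i : i \in D0 -> i \in P -> i \in D0 :\: E.
  by move=> D0i /setDP[_ iE]; apply/setDP.
split.
  apply: connect_trans cU (connect1 _); apply: reconf_upd => // i Di; rewrite ffunE.
  case: ifPn => [Pi|/(DPE' _ Di) iE]; first exact: comp.
  by move=> ex; case/negP: xC; rewrite -ex EC.
move=> i i' Di Di' /=; rewrite !ffunE.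
have [Di0 Di0'] := (subsetP D0D _ Di, subsetP D0D _ Di').
case: (i =P e) => [->|_]; case: (i' =P e) => [->|_] //.
- case: ifPn => [Pi|/(DPE' _ Di0') iE] ex.
    by case: (fresh i'); rewrite ?ex //; apply: D0P.
  by case/negP: xC; rewrite ex EC.
- case: ifPn => [Pi|/(DPE' _ Di0) iE] ex.
    by case: (fresh i); rewrite ?ex //; apply: D0P.
  by case/negP: xC; rewrite -ex EC.
case: ifPn => [Pi|/(DPE' _ Di0) iE]; case: ifPn => [Pi'|/(DPE' _ Di0') iE'] ex.
- by apply: inS => //; apply: D0P.
- by case/negP: (SC i Pi); rewrite ex EC.
- by case/negP: (SC i' Pi'); rewrite -ex EC.
- exact: inU.
Qed.

Lemma place_diff D E S T S1 e x (P := D :\: E) : E \subset D ->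
  diff D (upd (patch S P S1) e x) (upd (patch T P S1) e x) \subset E :\ e.
Proof.
move=> ED; apply/subsetP=> i /diffP[Di]; rewrite !ffunE in_setD1.
case: eqP => //= _; case: ifPn => // nP _.
by move: nP; rewrite in_setD Di andbT negbK.
Qed.

Lemma used_comps_diff_eq D S T : distinct_on (diff D S T) S -> distinct_on (diff D S T) T ->
  (forall d, d \in diff D S T -> (T d).1 \in used_comps S (diff D S T)) ->
  used_comps T (diff D S T) = used_comps S (diff D S T).
Proof.
move=> inS inT h; apply/eqP; rewrite eqEcard; apply/andP; split.
  by apply/subsetP=> j /imsetP[d dE ->]; apply: h.
by rewrite [X in X <= _]card_in_imset // [X in _ <= X]card_in_imset.
Qed.

(* Two transversals with a minimal set E of disagreements use the same components
   on E; freeing a component touched by E without moving E, in both at once, lets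
   one more block agree. *)
Lemma conn_surplus t D S T :
  (forall Q, Q \subset D -> Q != set0 -> #|Q| < #|touched t Q|) ->
  IT t D S -> IT t D T -> connect (reconf t D) S T.
Proof.
move=> sur iS0 iT0.
have hD Q : Q \subset D -> #|Q| <= #|touched t Q|.
  move=> QD; case: (boolP (Q == set0)) => [/eqP->|Q0]; first by rewrite cards0.
  exact: ltnW (sur Q QD Q0).
have [S' [cS iS inS]] := conn_distinct iS0 hD.
have [T' [cT iT inT]] := conn_distinct iT0 hD.
apply: connect_trans cS _; rewrite conn_sym in cT; apply: connect_trans _ cT.
move: {S T iS0 iT0} S' T' iS inS iT inT => S T.
elim: {S T}#|diff D S T| {-2}S {-2}T (leqnn #|diff D S T|) => [|n IH] S T.
  by rewrite leqn0 cards_eq0 => /eqP E0 iS _ _ _; apply: diff0_conn.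
set E := diff D S T => En iS inS iT inT.
have lt E' e : e \in E -> E' \subset E :\ e -> #|E'| <= n.
  move=> eE /subset_leq_card h; apply: leq_trans h _.
  by move: En; rewrite (cardsD1 e E) eE.
have ED : E \subset D by apply/subsetP=> i /diffP[].
case: (set_0Vmem E) => [E0|[e0 e0E]]; first exact: diff0_conn.
case: (boolP [exists d in E, (T d).1 \notin used_comps S E]) => [/exists_inP[d dE dn]|].
  have Dd := subsetP ED _ dE.
  have [m inS2 E2] := agree_step (subxx D) iS iT Dd dn inS inT.
  apply: connect_trans (connect1 m) _; apply: IH => //; first exact: lt E2.
  by case/reconfP: m.
move=> /exists_inPn nd.
have CE : used_comps T E = used_comps S E.
  apply: used_comps_diff_eq; try exact: distinct_sub ED _.
  by move=> d /nd; rewrite negbK.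
pose C := used_comps S E; pose P := D :\: E.
have PD : P \subset D by apply: subsetDl.
have ST i : i \in P -> S i = T i.
  by case/setDP=> Di iE; apply: diff_eq iE.
have SP i : i \in P -> (S i).1 \notin C.
  move=> /setDP[Di iE]; apply: contraNN iE => /imsetP[e eE ee].
  by rewrite (inS i e) //; apply: (subsetP ED).
have iSP : IT (avoiding t C) P S.
  case/ITP: (iS) => h1 h2; apply/ITP; split=> [i Pi|i i' Pi Pi'].
    by rewrite /avoiding h1 ?SP //; apply: (subsetP PD).
  by apply: h2; apply: (subsetP PD).
have soS : sole P P S.
  by move=> i i' Pi Pi'; apply: (distinct_sub PD inS).
have [B BP|e [S1 [x [eE c tx fr]]]] := augment (subxx P) iSP soS (X := E).
  have nE : (P :\: B) :&: E = set0.
    apply/setP=> i; rewrite in_set0; apply/negP=> /setIP[/setDP[/setDP[_ nE _]]].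
    exact/negP.
  have : #|(P :\: B) :|: E| < #|touched t ((P :\: B) :|: E)|.
    apply: sur; last by apply/set0Pn; exists e0; rewrite in_setU e0E orbT.
    rewrite subUset ED andbT; exact: subset_trans (subsetDl _ _) PD.
  have -> : #|(P :\: B) :|: E| = #|P :\: B| + #|E|.
    by rewrite cardsU nE cards0 subn0.
  have cC : #|C| = #|E| by apply: card_in_imset; apply: (distinct_sub ED inS).
  have : touched t ((P :\: B) :|: E) \subset C :|: touched (avoiding t C) ((P :\: B) :|: E).
    apply/subsetP=> j /touchedP[i [b [iQ tij]]]; rewrite in_setU orbC.
    case: (boolP (j \in C)) => [|jC]; first by rewrite orbT.
    by apply/orP; left; apply/touchedP; exists i, b; rewrite /avoiding tij.
  move=> /subset_leq_card h1 h2; have h3 := leq_trans h2 h1.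
  have := leq_trans h3 (leq_card_setU _ _); rewrite cC addnC ltn_add2l.
  exact: leq_ltn_trans (leq_imset_card _ _).
have {}eE : e \in E by move: eE; rewrite setDv setU0.
have [cS1 iS1 soS1 _] := reachP (subxx P) iSP soS c.
have inS1 : distinct_on P S1 by move=> i i' Pi Pi' /= ee; apply: soS1.
have [txx xC] := andP tx.
have cT1 : connect (reconf (avoiding t C) P) T S1.
  apply: connect_trans cS1; apply/connect1; rewrite reconf_sym; apply: reconf_eq => //.
have fr' i : i \in P -> (S1 i).1 = x.1 -> S1 i = x by move=> Pi ee; case: (fr i).
have TP i : i \in P -> (T i).1 \notin C by move=> Pi; rewrite -ST //; apply: SP.
have [cS3 inS3] := place (subxx D) ED iS (erefl C) SP inS cS1 inS1 eE txx xC fr' fr.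
have [cT3 inT3] := place (subxx D) ED iT CE TP inT cT1 inS1 eE txx xC fr' fr.
have iS3 := conn_IT iS cS3; have iT3 := conn_IT iT cT3.
rewrite conn_sym in cT3; apply: connect_trans cS3 _; apply: connect_trans _ cT3.
apply: IH => //; exact: lt eE (place_diff _ _ _ _ _ ED).
Qed.

Lemma confinedPn t R C Q j : j \in C -> j \notin confined t R C Q ->
  exists i b, [/\ i \in R, t i (j, b) & i \notin Q].
Proof.
move=> Cj; rewrite inE Cj /= => /forall_inPn[i Ri /forallPn[b]].
by rewrite negb_imply => /andP[]; exists i, b.
Qed.

(** A component of C not touched by Q is confined to the complement of Q. This trades upper bounds
    on [confined] for Hall-type lower bounds on [touched]. *)
Lemma card_touched_confined t D C Q : Q \subset D ->
  #|C| <= #|touched t Q| + #|confined t D C (D :\: Q)|.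
Proof.
move=> QD; apply: leq_trans (leq_card_setU _ _); apply: subset_leq_card.
apply/subsetP=> j Cj; rewrite in_setU.
case: (boolP (j \in confined t D C (D :\: Q))) => [|nj]; first by rewrite orbT.
have [i [b [Di tij iD]]] := confinedPn Cj nj.
by rewrite orbF; apply/touchedP; exists i, b; move: iD; rewrite in_setD Di andbT negbK.
Qed.

Lemma setD_neq D Q : Q \subset D -> Q != set0 -> D :\: Q != D.
Proof.
move=> QD /set0Pn[q qQ]; apply/eqP=> e.
by have := subsetP QD q qQ; rewrite -e in_setD qQ.
Qed.

Lemma hall_confined t D C : #|D| <= #|C| ->
  (forall Q, Q \subset D -> Q != D -> #|confined t D C Q| <= #|Q|) ->
  forall Q, Q \subset D -> #|Q| <= #|touched t Q|.
Proof.
move=> DC hc Q QD; case: (boolP (Q == set0)) => [/eqP->|Q0]; first by rewrite cards0.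
have h1 := hc _ (subsetDl D Q) (setD_neq QD Q0).
have := leq_trans DC (card_touched_confined t C QD).
rewrite -(cardsID Q D) (setIidPr QD) => h3.
by rewrite -(leq_add2r #|D :\: Q|); apply: leq_trans h3 _; rewrite leq_add2l.
Qed.

(* As in [conn_surplus], except that no component is free at first: the block k,
   which has no private side, makes room by joining another block. *)
Lemma conn_core t D C k S T :
  (forall i x, t i x -> x.1 \in C) -> k \in D -> #|D| = #|C| ->
  (forall x, t k x -> exists w, [/\ w \in D, w <> k & t w x]) ->
  (forall j, j \in C -> exists i b, i \in D /\ t i (j, b)) ->
  (forall Q, Q \subset D -> Q != set0 -> Q != D -> #|confined t D C Q| < #|Q|) ->
  IT t D S -> IT t D T -> connect (reconf t D) S T.
Proof.
move=> tC kD DC npr tou sur iS0 iT0.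
have hD : forall Q, Q \subset D -> #|Q| <= #|touched t Q|.
  apply: (hall_confined (C := C)); first by rewrite DC.
  move=> Q QD QnD; case: (boolP (Q == set0)) => [/eqP->|Q0]; last exact/ltnW/sur.
  rewrite cards0 leqn0 cards_eq0; apply/eqP/setP=> j; rewrite in_set0.
  apply/negP=> /confinedP[Cj h]; have [i [b [Di tij]]] := tou j Cj.
  by have := h i b Di tij; rewrite inE.
have [S' [cS iS inS]] := conn_distinct iS0 hD.
have [T' [cT iT inT]] := conn_distinct iT0 hD.
apply: connect_trans cS _; rewrite conn_sym in cT; apply: connect_trans _ cT.
move: {S T iS0 iT0} S' T' iS inS iT inT => S T iS inS iT inT.
have sDk : D :\ k \subset D by apply: subD1set.
have Tk : t k (T k) by case/ITP: iT => h _; apply: h.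
have [S1 [cS1 inS1 eS1]]: exists S1,
    [/\ connect (reconf t D) S S1, distinct_on D S1 & S1 k = T k].
  have npr0 x : t k x -> exists w, [/\ w \in D :|: set0, w <> k & t w x].
    by rewrite setU0; apply: npr.
  have sur0 Q : Q \subset D -> Q != set0 -> Q != D ->
      #|confined t (D :|: set0) C Q| < #|Q| by rewrite setU0; apply: sur.
  (* With no block waiting outside, nothing is placeable; so the component of [T k] can be emptied
     and k moved to its target. *)
  have [[U [o [x []]]]|ev] := release tC kD DC npr0 sur0 iS (distinct_sub sDk inS).
    by move=> _; rewrite inE.
  have [U [[cU iU inU] fU]] := ev _ (tC _ _ Tk).
  have m : reconf t D U (upd U k (T k)) by apply: reconf_upd => // i Di e; case: (fU i).
  exists (upd U k (T k)); split; last by rewrite updE.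
    exact: connect_trans cU (connect1 m).
  move=> i i' Di Di' /=; rewrite !ffunE.
  case: (i =P k) => [ik|ik]; case: (i' =P k) => [ik'|ik'] e.
  - by rewrite ik ik'.
  - by case: (fU i').
  - by case: (fU i).
  - by apply: inU => //; rewrite !inE ?Di ?Di' andbT; apply/eqP.
have iS1 := conn_IT iS cS1; apply: connect_trans cS1 _.
have DkP i : i \in D :\ k -> i \in D /\ i <> k by rewrite !inE => /andP[/eqP].
have kE1 : k \notin diff D S1 T by apply/negP=> /diffP[_]; apply.
have hS i : i \in diff D S1 T -> (S1 i).1 <> (S1 k).1.
  by move=> iE e; case/negP: kE1; rewrite -(inS1 i k) //; case/diffP: iE.
have hT i : i \in diff D S1 T -> (T i).1 <> (T k).1.
  by move=> iE e; case/negP: kE1; rewrite -(inT i k) //; case/diffP: iE.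
have {}inS1 := distinct_sub sDk inS1; have {}inT := distinct_sub sDk inT.
move: {iS inS hD}iS1 inS1 iT inT eS1 hS hT {kE1 Tk}.
elim: {S1 T}#|diff D S1 T| {-2}S1 {-2}T (leqnn #|diff D S1 T|) => {S}[|n IH] S T.
  by rewrite leqn0 cards_eq0 => /eqP E0 iS _ _ _ _ _ _; apply: diff0_conn.
set E := diff D S T => En iS inS iT inT ek hS hT.
have ED : E \subset D by apply/subsetP=> i /diffP[].
case: (set_0Vmem E) => [E0|[e0 e0E]]; first exact: diff0_conn.
have kE : k \notin E by apply/negP=> /diffP[_]; apply.
have ED1 : E \subset D :\ k.
  by apply/subsetP=> i iE; rewrite in_setD1 (subsetP ED) // andbT; apply: contraNneq kE => <-.
have lt E' e : e \in E -> E' \subset E :\ e -> #|E'| <= n.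
  move=> eE /subset_leq_card h; apply: leq_trans h _.
  by move: En; rewrite (cardsD1 e E) eE.
have neE e i : e \in E -> i \in E :\ e -> i != e /\ i \in E.
  by move=> _; rewrite in_setD1 => /andP.
case: (boolP [exists d in E, (T d).1 \notin used_comps S E]) => [/exists_inP[d dE dn]|].
  have Dd := subsetP ED _ dE.
  have [m inS2 E2] := agree_step sDk iS iT Dd dn inS inT.
  have kd : k != d by apply: contraNneq kE => ->.
  apply: connect_trans (connect1 m) _; apply: IH => //.
  - exact: lt E2.
  - by case/reconfP: m.
  - by rewrite updN.
  - by move=> i /(subsetP E2)/(neE _ _ dE)[id iE]; rewrite !updN //; apply: hS.
  - by move=> i /(subsetP E2)/(neE _ _ dE)[id iE]; apply: hT.
move=> /exists_inPn nd.
have CE : used_comps T E = used_comps S E.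
  apply: used_comps_diff_eq; try exact: distinct_sub ED1 _.
  by move=> d /nd; rewrite negbK.
pose K := used_comps S E; pose P := D :\: E.
have PD : P \subset D by apply: subsetDl.
have PE : P :|: E = D.
  apply/setP=> i; rewrite in_setU in_setD; case: (boolP (i \in E)); last by rewrite orbF.
  by move/(subsetP ED)->.
have kP : k \in P by apply/setDP.
have ST i : i \in P -> S i = T i.
  by case/setDP=> Di iE; apply: diff_eq iE.
have SP i : i \in P -> (S i).1 \notin K.
  move=> /setDP[Di iE]; apply/imsetP=> -[e eE ee].
  case: (i =P k) => [ik|/eqP ik]; first by case: (hS e eE); rewrite -ee ik.
  have De := subsetP ED1 _ eE.
  by case/negP: iE; rewrite (inS i e) // in_setD1 ik.
have TP i : i \in P -> (T i).1 \notin K by move=> Pi; rewrite -ST //; apply: SP.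
have iSP : IT (avoiding t K) P S.
  case/ITP: (iS) => h1 h2; apply/ITP; split=> [i Pi|i i' Pi Pi'].
    by rewrite /avoiding h1 ?SP //; apply: (subsetP PD).
  by apply: h2; apply: (subsetP PD).
have KC : K \subset C.
  apply/subsetP=> j /imsetP[e eE ->]; apply: (tC e).
  by case/ITP: iS => h _; apply: h; apply: (subsetP ED).
have tC' i x : avoiding t K i x -> x.1 \in C :\: K.
  by case/andP=> tx xK; apply/setDP; split=> //; apply: tC tx.
have PC : #|P| = #|C :\: K|.
  rewrite !cardsD (setIidPr ED) (setIidPr KC) DC; congr (_ - _).
  by rewrite card_in_imset //; apply: distinct_sub ED1 inS.
have npr' x : avoiding t K k x -> exists w, [/\ w \in P :|: E, w <> k & avoiding t K w x].
  case/andP=> tx xK; have [w [Dw wk tw]] := npr x tx.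
  by exists w; rewrite PE /avoiding tw.
have sub Q : confined (avoiding t K) (P :|: E) (C :\: K) Q \subset confined t D C Q.
  rewrite PE; apply/subsetP=> j /confinedP[/setDP[Cj Kj] h]; apply/confinedP; split=> // i b Di tij.
  by apply: (h i b) => //; rewrite /avoiding tij.
have sur' Q : Q \subset P -> Q != set0 -> Q != P ->
    #|confined (avoiding t K) (P :|: E) (C :\: K) Q| < #|Q|.
  move=> QP Q0 _; apply: leq_ltn_trans (subset_leq_card (sub Q)) _.
  apply: sur => //; first exact: subset_trans QP PD.
  apply/eqP=> QD; have := subsetP ED _ e0E; rewrite -QD => /(subsetP QP).
  by rewrite in_setD e0E.
have DkE : D :\ k :\: E = P :\ k by rewrite setDDl setUC -setDDl.
have inSP : distinct_on (P :\ k) S by apply: distinct_sub inS; rewrite -DkE subsetDl.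
have [S1 [e [x [[cS1 _ inS1] eE tx fr comp]]]]: placeable (avoiding t K) P E k S.
  have [//|ev] := release tC' kP PC npr' sur' iSP inSP.
  (* P is a proper part of D, so fewer than |P| = |C \ K| components are confined to it, and some e
     in E touches a component outside K. That component can be emptied for e. *)
  have [j [e [b [jC eE tj]]]]: exists j e b, [/\ j \in C :\: K, e \in E & avoiding t K e (j, b)].
    have PnD : P != D.
      by apply/eqP=> PD'; have := subsetP ED _ e0E; rewrite -PD' in_setD e0E.
    have P0 : P != set0 by apply/set0Pn; exists k.
    have := sur _ PD P0 PnD; rewrite PC => lt'.
    have: ~~ (C :\: K \subset confined t D C P).
      by apply/negP=> /subset_leq_card; rewrite leqNgt lt'.
    case/subsetPn=> j jCK jn; have /setDP[Cj Kj] := jCK.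
    have [e [b [De tj eP]]] := confinedPn Cj jn.
    exists j, e, b; rewrite /avoiding tj; split=> //.
    by move: eP; rewrite in_setD De andbT negbK.
  have [U [rU fU]] := ev j jC; exists U, e, (j, b); split=> //.
    by move=> i; rewrite in_setD1 => /andP[_ Pi]; apply: fU.
  by move=> h; case: (fU k kP).
have [txx xK] := andP tx.
have comp' i : i \in P -> (S1 i).1 = x.1 -> S1 i = x.
  move=> Pi; case: (i =P k) => [->|/eqP ik]; first exact: comp.
  by move=> h; case: (fr i) => //; rewrite in_setD1 ik.
have cT1 : connect (reconf (avoiding t K) P) T S1.
  by apply: connect_trans cS1; apply/connect1; rewrite reconf_sym; apply: reconf_eq.
have iS1 := conn_IT iSP cS1.
rewrite -DkE in inS1 fr.
have [cS3 inS3] := place sDk ED iS (erefl K) SP inS cS1 inS1 eE txx xK comp' fr.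
have [cT3 inT3] := place sDk ED iT CE TP inT cT1 inS1 eE txx xK comp' fr.
have iS3 := conn_IT iS cS3; have iT3 := conn_IT iT cT3.
have ke : k != e by apply: contraNneq kE => ->.
have kv U : upd (patch U P S1) e x k = S1 k by rewrite updN // ffunE kP.
have S1k : (S1 k).1 \notin K by case/ITP: iS1 => h _; case/andP: (h k kP).
have sE := place_diff S T S1 e x ED.
have val U i : i \in E :\ e -> upd (patch U P S1) e x i = U i.
  by rewrite in_setD1 => /andP[ie iE]; rewrite updN // ffunE in_setD iE.
rewrite conn_sym in cT3; apply: connect_trans cS3 _; apply: connect_trans _ cT3.
apply: IH => //.
- exact: lt eE sE.
- by rewrite !kv.
- move=> i /(subsetP sE) iE; rewrite kv val // => h; case/negP: S1k; rewrite -h.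
  by apply/imsetP; exists i => //; case: (neE _ _ eE iE).
- move=> i /(subsetP sE) iE; rewrite kv val // => h; case/negP: S1k; rewrite -h /K -CE.
  by apply/imsetP; exists i => //; case: (neE _ _ eE iE).
Qed.

Lemma IT_extend t D S i x : IT t (D :\ i) S -> t i x ->
  (forall i', i' \in D :\ i -> (S i').1 = x.1 -> S i' = x) -> IT t D (upd S i x).
Proof.
move=> /ITP[h1 h2] tx hx; apply/ITP.
have hin k : k \in D -> k <> i -> k \in D :\ i by rewrite in_setD1 => -> /eqP->.
split=> [k Dk|k k' Dk Dk']; rewrite !ffunE.
  by case: eqP => [->|ki] //; apply/h1/hin.
case: eqP => ki; case: eqP => ki' // e.
- by symmetry; apply: hx => //; apply: hin.
- by apply: hx => //; apply: hin.
- by apply: h2 => //; apply: hin.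
Qed.

Definition within t C : I -> J * bool -> bool := fun i x => t i x && (x.1 \in C).

(** * Minimal tight sets of blocks *)

Section Inner.

Variables (t : I -> J * bool -> bool) (D : {set I}) (C : {set J}) (P : {set I}).
Hypotheses (PD : P \subset D) (Pc : #|P| <= #|confined t D C P|).
Hypothesis Pmin :
  forall Q, Q \subset P -> Q != set0 -> Q != P -> #|confined t D C Q| < #|Q|.
Let K := confined t D C P.

Lemma inner_confined Q : Q \subset P -> confined (within t K) P K Q \subset confined t D C Q.
Proof.
move=> QP; apply/subsetP=> j /confinedP[/[dup] jK /confinedP[Cj h] h'].
apply/confinedP; split=> // i b Di tij; apply: (h' i b); first exact: (h i b).
by rewrite /within tij.
Qed.

(** By minimality fewer than |P \ Q| components are confined to P \ Q, so more than |Q| of the at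
    least |P| components of [K] meet Q. *)
Lemma inner_surplus Q : Q \subset P -> Q != set0 -> Q != P ->
  #|Q| < #|touched (within t K) Q|.
Proof.
move=> QP Q0 QnP.
have D0 : P :\: Q != set0 by rewrite setD_eq0; apply: contraNN QnP => PQ; rewrite eqEsubset QP.
have h1 := Pmin (subsetDl P Q) D0 (setD_neq QP Q0).
have h2 := leq_trans Pc (card_touched_confined (within t K) K QP).
have h3 := subset_leq_card (inner_confined (subsetDl P Q)).
have cPQ : #|Q| + #|P :\: Q| = #|P| by rewrite -{1}(setIidPr QP) cardsID.
rewrite -(ltn_add2r #|P :\: Q|) cPQ.
apply: leq_ltn_trans h2 _; rewrite ltn_add2l; exact: leq_ltn_trans h3 h1.
Qed.

Lemma inner_touched : K \subset touched (within t K) P :|: confined t D C set0.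
Proof.
apply/subsetP=> j jK; rewrite in_setU.
case: (boolP (j \in confined t D C set0)) => [|j0]; first by rewrite orbT.
have /confinedP[Cj h] := jK; have [i [b [Di tij _]]] := confinedPn Cj j0.
by rewrite orbF; apply/touchedP; exists i, b; rewrite /within tij; split=> //; apply: h tij.
Qed.

Lemma inner_IT S0 : confined t D C set0 = set0 -> exists S, IT (within t K) P S /\ distinct_on P S.
Proof.
move=> c0; apply: hall => // Q QP.
case: (boolP (Q == set0)) => [/eqP->|Q0]; first by rewrite cards0.
case: (Q =P P) => [->|/eqP QnP]; last exact/ltnW/inner_surplus.
by apply: leq_trans Pc _; apply: subset_leq_card; have := inner_touched; rewrite c0 setU0.
Qed.

(** A component of [K] has no vertex in the blocks of D outside P, so the two parts cannot
    conflict. *)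
Lemma inner_patch F S : IT t (D :\: P) F -> IT (within t K) P S -> IT t D (patch F P S).
Proof.
move=> iF; apply: patch_IT => // i x Pi /andP[tx /confinedP[_ h]]; split=> // e /[dup] eDP.
case/setDP=> De nP ex; case/negP: nP; apply: (h e (F e).2) => //.
by rewrite ex -surjective_pairing; case/ITP: iF => h1 _; apply: h1.
Qed.

End Inner.

Lemma minimal_tight t D C (p : pred {set I}) Q0 :
  p =1 (fun Q => [&& Q \subset D, Q != set0 & #|Q| <= #|confined t D C Q|]) ->
  p Q0 -> exists P, [/\ p P & forall Q, Q \subset P -> Q != set0 -> Q != P ->
    #|confined t D C Q| < #|Q|].
Proof.
move=> ep pQ; have [P /minsetP[pP minP] _] := minset_exists pQ.
exists P; split=> // Q QP Q0'; apply: contraNT; rewrite -leqNgt => Qc.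
apply/eqP/minP => //; rewrite ep Q0' Qc /= andbT.
by move: pP; rewrite ep => /and3P[PD _ _]; apply: subset_trans QP PD.
Qed.

(** Otherwise there is a minimal tight set P, which has a transversal inside its own components.
    Deleting one block of P leaves a transversal, whose part outside P glues to it, contradicting
    [noIT]. *)
Lemma minimal_noIT_surplus t D C : confined t D C set0 = set0 ->
  (forall S, ~ IT t D S) -> (forall i, i \in D -> exists S, IT t (D :\ i) S) ->
  forall Q, Q \subset D -> Q != set0 -> #|confined t D C Q| < #|Q|.
Proof.
move=> c0 noIT minIT Q QD Q0; rewrite ltnNge; apply/negP=> Qc.
pose p R := [&& R \subset D, R != set0 & #|R| <= #|confined t D C R|].
have [|P [/and3P[PD /set0Pn[q qP] Pc] minP]] := @minimal_tight t D C p Q (fun=> erefl).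
  by rewrite /p QD Q0.
have [F iF] := minIT q (subsetP PD _ qP).
have [N [iN _]] := inner_IT Pc minP F c0.
apply: (noIT (patch F P N)); apply: inner_patch iN => //.
apply: IT_sub iF; apply/subsetP=> i /setDP[Di iP]; rewrite in_setD1 Di andbT.
by apply: contraNneq iP => ->.
Qed.

(* Put k in place of a block i0 that obstructs it; if k had no private side, then
   [release] would make room for i0. *)
Lemma private_of_minimal_noIT t D C k :
  (forall i x, t i x -> x.1 \in C) -> confined t D C set0 = set0 -> #|D| = #|C|.+1 ->
  (forall S, ~ IT t D S) -> (forall i, i \in D -> exists S, IT t (D :\ i) S) ->
  k \in D -> D :\ k != set0 ->
  exists x, t k x /\ forall i, i \in D -> t i x -> i = k.
Proof.
move=> tC c0 DC noIT minIT kD Dk0.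
case: (boolP [exists x, t k x && [forall i in D, t i x ==> (i == k)]]) => [|npr].
  case/existsP=> x /andP[tx /forall_inP h]; exists x; split=> // i Di ti.
  by apply/eqP; apply: (implyP (h i Di)).
exfalso; have sur := minimal_noIT_surplus c0 noIT minIT.
have {}npr x : t k x -> exists w, [/\ w \in D, w <> k & t w x].
  move=> tx; move/existsPn: npr => /(_ x); rewrite tx /= => /forall_inPn[w Dw].
  by rewrite negb_imply => /andP[tw /eqP wk]; exists w.
have Dk : #|D :\ k| = #|C| by move: DC; rewrite (cardsD1 k D) kD => -[].
have sDk : D :\ k \subset D by apply: subD1set.
have [F _] := minIT k kD.
have [|R [iR inR]] := @hall _ _ t (D :\ k) F.
  apply: (hall_confined (C := C)); first by rewrite Dk.
  move=> Q QD _; rewrite -ltnS.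
  have sub : confined t (D :\ k) C Q \subset confined t D C (k |: Q).
    apply/subsetP=> j /confinedP[Cj h]; apply/confinedP; split=> // i b Di tij; apply/setU1P.
    by case: (i =P k) => [|/eqP ik]; [left|right; apply: (h i b) => //; rewrite in_setD1 ik].
  apply: leq_ltn_trans (subset_leq_card sub) _.
  have : #|confined t D C (k |: Q)| < #|k |: Q|.
    apply: sur; last by apply/set0Pn; exists k; rewrite setU11.
    by rewrite subUset sub1set kD (subset_trans QD).
  move=> /leq_trans; apply; rewrite cardsU1; case: (k \notin Q) => //=; exact: leqW.
have [j jC jn]: exists2 j, j \in C & j \notin confined t D C (D :\ k).
  have := sur _ sDk Dk0; rewrite Dk => lt.
  have : ~~ (C \subset confined t D C (D :\ k)).
    by apply/negP=> /subset_leq_card; rewrite leqNgt lt.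
  by case/subsetPn=> j; exists j.
have [b tkb]: exists b, t k (j, b).
  have [i [b [Di tij]]] := confinedPn jC jn; rewrite in_setD1 Di andbT negbK => /eqP <-.
  by exists b.
(* Since |D \ k| = |C|, the component j wanted by k is occupied; its holder [i0] is the block to
   displace. *)
have cR : used_comps R (D :\ k) = C.
  apply/eqP; rewrite eqEcard card_in_imset // Dk leqnn andbT.
  by apply/subsetP=> j' /imsetP[i Di ->]; apply: (tC i); case/ITP: iR => h _; apply: h.
have [i0 Di0 ei0]: exists2 i, i \in D :\ k & (R i).1 = j.
  by move: jC; rewrite -cR => /imsetP[i Di ->]; exists i.
have [i0k iD0] := setD1P Di0.
pose S := upd R k (j, b); pose P := D :\ i0.
have PO : P :|: [set i0] = D by rewrite setUC setD1K.
have kP : k \in P by rewrite in_setD1 eq_sym i0k.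
have PkR : P :\ k \subset D :\ k by rewrite setSD // subD1set.
have iRk : IT t (P :\ k) R by apply: IT_sub iR.
have fresh i : i \in P :\ k -> (R i).1 <> j.
  move=> Pi; rewrite -ei0 => e; have Di := subsetP PkR _ Pi.
  by move: Pi; rewrite (inR _ _ Di Di0 e) !in_setD1 eqxx andbF.
have iS : IT t P S.
  by apply: IT_extend iRk tkb _ => i Pi e; case: (fresh i Pi).
have inS : distinct_on (P :\ k) S.
  move=> i i' Pi Pi' /=; rewrite !updN; try by move: Pi Pi'; rewrite !in_setD1 => /andP[] // ? _ /andP[].
  by apply: inR; apply: (subsetP PkR).
have PC : #|P| = #|C| by move: DC; rewrite (cardsD1 i0 D) iD0 => -[].
have npr' x : t k x -> exists w, [/\ w \in P :|: [set i0], w <> k & t w x].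
  by rewrite PO; apply: npr.
have PD : P \subset D by apply: subD1set.
have sur' Q : Q \subset P -> Q != set0 -> Q != P ->
    #|confined t (P :|: [set i0]) C Q| < #|Q|.
  by rewrite PO => QP Q0 _; apply: sur => //; apply: subset_trans QP PD.
have final U x : IT t P U -> t i0 x ->
    (forall i, i \in P -> (U i).1 = x.1 -> U i = x) -> False.
  by move=> iU tx hx; apply: (noIT (upd U i0 x)); apply: IT_extend iU tx hx.
have [[U [o [x [[_ iU _] /set1P-> tx fr cp]]]]|ev] := release tC kP PC npr' sur' iS inS.
  apply: (final U x) => // i Pi e; case: (i =P k) => [ik|/eqP ik].
    by move: e; rewrite ik; apply: cp.
  by case: (fr i) => //; rewrite in_setD1 ik.
have P0 : P != set0 by apply/set0Pn; exists k.
have := sur P PD P0; rewrite PC => lt.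
have : ~~ (C \subset confined t D C P).
  by apply/negP=> /subset_leq_card; rewrite leqNgt lt.
case/subsetPn=> j' jC' jn'; have [i [b' [Di tij]]] := confinedPn jC' jn'.
rewrite in_setD1 Di andbT negbK => /eqP ei; have [U [[_ iU _] fU]] := ev j' jC'.
apply: (final U (j', b')) => //; first by rewrite -ei.
by move=> i' Pi' e; case: (fU i').
Qed.

End Connectivity.

(** * Minimally disconnected instances *)

Section MinimalDisconnected.

Variables I J : finType.
Implicit Types (Q : {set I}) (S T F N U : {ffun I -> J * bool}) (x y : J * bool).
Variables (t : I -> J * bool -> bool) (D : {set I}) (C : {set J}).
Hypotheses (tC : forall i x, t i x -> x.1 \in C) (DC : #|D| = #|C|).
Hypothesis c0 : confined t D C set0 = set0.
Hypothesis minconn : forall i S T, i \in D ->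
  IT t (D :\ i) S -> IT t (D :\ i) T -> connect (reconf t (D :\ i)) S T.

Section Tight.

Variable P : {set I}.
Hypotheses (PD : P \subset D) (P0 : P != set0) (Pc : #|P| <= #|confined t D C P|).
Hypothesis Pmin : forall Q, Q \subset P -> Q != set0 -> Q != P ->
  #|confined t D C Q| < #|Q|.
Let K := confined t D C P.
Let O := D :\: P.

(** Availability to P of a vertex outside [K]. The set [E] is a parameter because this is also
    tested after a block outside P has been deleted. *)
Definition extra (F : {ffun I -> J * bool}) (E : {set I}) :=
  [exists i in P, exists x, [&& t i x, x.1 \notin K & [forall e in E, compatible x (F e)]]].

Definition inner_conn := forall N N', IT (within t K) P N -> IT (within t K) P N' ->
  connect (reconf (within t K) P) N N'.

Lemma K_inner i x : i \in D -> t i x -> x.1 \in K -> i \in P.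
Proof. by move=> Di + /confinedP[_ h]; case: x h => j b h; apply: h. Qed.

Lemma outer_notK F i : IT t O F -> i \in O -> (F i).1 \notin K.
Proof.
move=> /ITP[h _] Oi; have /setDP[Di nP] := Oi.
by apply: contraNN nP; apply: K_inner => //; apply: h.
Qed.

Lemma outer_sub : O \subset D. Proof. exact: subsetDl. Qed.

Lemma DO : D :\: O = P.
Proof. by rewrite /O setDDr setDv set0U; apply/setIidPr. Qed.

(** Delete a block of P: by minimality the rest is connected, so the blocks outside P can be led
    from F to F'. With N keeping P inside [K], which no outer block touches, P can stand still all
    the while. *)
Lemma glue_conn F F' N : IT t O F -> IT t O F' -> IT (within t K) P N ->
  connect (reconf t D) (patch F P N) (patch F' P N).
Proof.
move=> iF iF' iN; have iG := inner_patch PD iF iN; have iG' := inner_patch PD iF' iN.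
have [p Pp] := set0Pn _ P0; have Dp := subsetP PD _ Pp.
have sub1 : D :\ p \subset D by apply: subD1set.
have cp := minconn Dp (IT_sub sub1 iG) (IT_sub sub1 iG').
have OD : O \subset D :\ p.
  apply/subsetP=> i /setDP[Di iP]; rewrite in_setD1 Di andbT.
  by apply: contraNneq iP => ->.
have {}cp := conn_sub OD cp.
pose W := patch F P N.
have iW : IT t (D :\: O) W by rewrite DO; apply: IT_sub iG.
have hW i x : i \in O -> t i x ->
    t i x /\ forall e, e \in D :\: O -> x.1 = (W e).1 -> x = W e.
  move=> Oi tx; split=> // e; rewrite DO => eP; rewrite ffunE eP => ex.
  have /setDP[Di /negP[]] := Oi; apply: (K_inner Di tx).
  by rewrite ex; case/ITP: iN => hN _; case/andP: (hN e eP).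
apply: connect_trans (connect_trans (patch_conn outer_sub iW hW cp) _).
  by apply/connect1/reconf_eq => // i Di; rewrite !ffunE if_same.
apply/connect1; rewrite reconf_sym; apply: reconf_eq => // i Di; rewrite !ffunE in_setD Di andbT.
by case: (i \in P).
Qed.

(** With F frozen, either disjunct offers P more than |P| components: [K] is larger, or a component
    outside [K] is added to it. Proper parts of P have surplus already inside [K], so [conn_surplus]
    applies. *)
Lemma fiber_conn F S T : IT t O F -> (#|P| < #|K|) || extra F O ->
  IT t D (patch F P S) -> IT t D (patch F P T) ->
  connect (reconf t D) (patch F P S) (patch F P T).
Proof.
move=> iF big iS iT.
pose tF i x := t i x && [forall e in O, compatible x (F e)].
have iPF U : IT t D (patch F P U) -> IT tF P U.
  move=> /ITP[h1 h2]; apply/ITP; split=> [i Pi|i i' Pi Pi' e].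
    have Di := subsetP PD _ Pi; rewrite /tF; have := h1 i Di; rewrite ffunE Pi => -> /=.
    apply/forall_inP=> e /setDP[De nP]; apply/compatibleP.
    by have := h2 i e Di De; rewrite !ffunE Pi (negPf nP).
  by have := h2 i i' (subsetP PD _ Pi) (subsetP PD _ Pi'); rewrite !ffunE Pi Pi'; apply.
apply: (patch_conn (t' := tF)) => //.
  by move=> i x Pi /andP[tx /forall_inP h]; split=> // e /h/compatibleP.
apply: conn_surplus; try exact: iPF.
have touched_sub Q : Q \subset P -> touched (within t K) Q \subset touched tF Q.
  move=> QP; apply/subsetP=> j /touchedP[i [b [iQ /andP[tij jK]]]].
  apply/touchedP; exists i, b; split=> //; rewrite /tF tij; apply/forall_inP=> e Oe.
  apply/compatibleP=> /= ej; move: (outer_notK iF Oe); rewrite -ej; move: jK => /= -> //.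
move=> Q QP Q0; case: (Q =P P) => [->|/eqP QnP]; last first.
  apply: leq_trans (inner_surplus Pc Pmin QP Q0 QnP) _.
  exact/subset_leq_card/touched_sub.
have KP : K \subset touched tF P.
  apply: subset_trans (touched_sub P (subxx P)).
  by have := inner_touched t D C P; rewrite c0 setU0.
case/orP: big => [lt|/exists_inP[i Pi /existsP[x /and3P[tx xK h]]]].
  exact: leq_trans lt (subset_leq_card KP).
apply: leq_ltn_trans Pc _; apply/proper_card/properP; split=> //.
by exists x.1 => //; apply/touchedP; exists i, x.2; rewrite -surjective_pairing /tF tx.
Qed.

Lemma patch_id S : IT t D S -> connect (reconf t D) S (patch S P S).
Proof.
by move=> iS; apply/connect1/reconf_eq => // i _; rewrite ffunE if_same.
Qed.

Lemma inner_or_extra S : IT t D S -> IT (within t K) P S \/ extra S O.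
Proof.
move=> /ITP[h1 h2]; case: (boolP [forall i in P, (S i).1 \in K]).
  move=> /forall_inP h; left; apply/ITP; split=> [i Pi|i i' Pi Pi'].
    by rewrite /within h // h1 // (subsetP PD).
  by apply: h2; apply: (subsetP PD).
move=> /forall_inPn[i Pi iK]; right; apply/exists_inP; exists i => //.
apply/existsP; exists (S i); rewrite iK h1 ?(subsetP PD) //.
by apply/forall_inP=> e /setDP[De _]; apply/compatibleP; apply: h2; rewrite // (subsetP PD).
Qed.

(** One good outer transversal F is enough. If S has P inside [K], change its outer part to F and
    then move within the fiber of F. If not, S itself shows that its outer part is good, so P can be
    brought to N first and the outer part changed to F afterwards. *)
Lemma conn_of_big F N : IT t O F -> (#|P| < #|K|) || extra F O ->
  IT (within t K) P N -> forall S, IT t D S -> connect (reconf t D) S (patch F P N).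
Proof.
move=> iF big iN S iS; have iSO := IT_sub outer_sub iS.
apply: connect_trans (patch_id iS) _.
have iSS : IT t D (patch S P S) by apply: conn_IT iS (patch_id iS).
case: (inner_or_extra iS) => [inS|exS].
  apply: connect_trans (glue_conn iSO iF inS) _.
  exact: fiber_conn iF big (inner_patch PD iF inS) (inner_patch PD iF iN).
apply: connect_trans (glue_conn iSO iF iN).
by apply: fiber_conn iSO _ iSS (inner_patch PD iSO iN); rewrite exS orbT.
Qed.

Lemma conn_of_inner : inner_conn -> (forall F, IT t O F -> ~~ extra F O) ->
  forall S T, IT t D S -> IT t D T -> connect (reconf t D) S T.
Proof.
move=> ic nbig S T iS iT.
have inn U : IT t D U -> IT (within t K) P U.
  move=> iU; case: (inner_or_extra iU) => // exU.
  by case/negP: (nbig U (IT_sub outer_sub iU)).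
apply: connect_trans (patch_id iS) _.
have iSO := IT_sub outer_sub iS; have iTO := IT_sub outer_sub iT.
apply: connect_trans (_ : connect _ (patch S P T) _); last first.
  apply: connect_trans (glue_conn iSO iTO (inn T iT)) _.
  by rewrite conn_sym; apply: patch_id.
apply: patch_conn (ic _ _ (inn S iS) (inn T iT)) => // i x Pi /andP[tx xK].
split=> // e Oe ex; case/negP: (outer_notK iSO Oe); by rewrite -ex.
Qed.

Lemma inner_conn_core k : #|P| = #|K| -> k \in P ->
  (forall x, t k x -> exists w, [/\ w \in D, w <> k & t w x]) -> inner_conn.
Proof.
move=> PK kP npr N N'; apply: conn_core kP PK _ _ _.
- by move=> i x /andP[].
- move=> x /andP[tx xK]; have [w [Dw wk tw]] := npr x tx.
  by exists w; rewrite /within tw xK (K_inner Dw tw xK).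
- move=> j jK; have /confinedP[Cj h] := jK.
  have : j \notin confined t D C set0 by rewrite c0 inE.
  move=> /(confinedPn Cj)[i [b [Di tij _]]]; exists i, b.
  by rewrite /within tij; split=> //; apply: h tij.
- move=> Q QP Q0 QnP; apply: leq_ltn_trans (Pmin QP Q0 QnP).
  exact/subset_leq_card/inner_confined.
Qed.

(** Under the hypothesis on [extra], every transversal of D without k keeps P inside [K]. A path in
    that instance, connected by minimality, therefore projects to a path of P inside [K]; F extends
    N and N' to its two ends. *)
Lemma inner_conn_outer k F : k \in O -> IT t O F ->
  (forall U, IT t (O :\ k) U -> ~~ extra U (O :\ k)) -> inner_conn.
Proof.
move=> kO iF nex N N' iN iN'; have /setDP[kD kP] := kO.
have sub1 : D :\ k \subset D by apply: subD1set.
have iG U : IT (within t K) P U -> IT t (D :\ k) (patch F P U).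
  by move=> iU; exact: IT_sub sub1 (inner_patch PD iF iU).
have PDk : P \subset D :\ k.
  apply/subsetP=> i Pi; rewrite in_setD1 (subsetP PD) // andbT.
  by apply: contraNneq kP => <-.
have ODk : O :\ k \subset D :\ k by rewrite setSD // subsetDl.
have inn U : IT t (D :\ k) U -> IT (within t K) P U.
  move=> iU; have := nex U (IT_sub ODk iU); case/ITP: iU => h1 h2 nx.
  apply/ITP; split=> [i Pi|i i' Pi Pi']; last by apply: h2; apply: (subsetP PDk).
  have Di := subsetP PDk _ Pi.
  rewrite /within h1 //=; apply: contraNT nx => iK; apply/exists_inP; exists i => //.
  apply/existsP; exists (U i); rewrite iK h1 //.
  by apply/forall_inP=> e eO; apply/compatibleP; apply: h2 => //; apply: (subsetP ODk).
have : connect (reconf (within t K) P) (patch F P N) (patch F P N').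
  apply: connect_sub (minconn kD (iG _ iN) (iG _ iN')) => U U' /reconfP[iU iU' h].
  apply: connect1; apply/reconfP; split; try exact: inn.
  by move=> i i' Pi Pi'; apply: h; apply: (subsetP PDk).
move=> c; apply: connect_trans (connect_trans c _); apply: connect1.
  by apply: reconf_eq => // i Pi; rewrite ffunE Pi.
by rewrite reconf_sym; apply: reconf_eq => // i Pi; rewrite ffunE Pi.
Qed.

(* The block p0 stands for all of P, with only the labels outside K. *)
Lemma outer_private k F : #|P| = #|K| -> k \in O -> IT t O F ->
  (forall F, IT t O F -> ~~ extra F O) ->
  (forall i, i \in O -> exists2 U, IT t (O :\ i) U & extra U (O :\ i)) ->
  exists x, t k x /\ forall i, i \in D -> t i x -> i = k.
Proof.
move=> PK kO iF nbig minU; have [p0 Pp0] := set0Pn _ P0.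
pose tt i x := (x.1 \notin K) && (if i == p0 then [exists p in P, t p x] else t i x).
have p0O : p0 \notin O by rewrite in_setD Pp0.
have ttO i x : i \in O -> t i x -> tt i x.
  move=> Oi tx; have /setDP[Di nP] := Oi; rewrite /tt.
  have -> : (i == p0) = false by apply: contraNF p0O => /eqP<-.
  by rewrite tx andbT; apply: contraNN nP; apply: K_inner.
have ttO' i x : i \in O -> tt i x -> t i x.
  move=> Oi; rewrite /tt; have -> // : (i == p0) = false by apply: contraNF p0O => /eqP<-.
  by case/andP.
have ttp x p : p \in P -> t p x -> x.1 \notin K -> tt p0 x.
  by move=> Pp tx xK; rewrite /tt xK eqxx; apply/exists_inP; exists p.
have ttp' x : tt p0 x -> x.1 \notin K /\ exists2 p, p \in P & t p x.
  by rewrite /tt eqxx => /andP[-> /exists_inP[p Pp tx]]; split=> //; exists p.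
have sO i : i \in O -> i \in p0 |: O by move=> Oi; apply/setU1P; right.
have KC : K \subset C by apply/subsetP=> j /confinedP[].
case: (@private_of_minimal_noIT _ _ tt (p0 |: O) (C :\: K) k).
- move=> i x; rewrite /tt in_setD => /andP[-> /=]; case: ifP => _; last exact: tC.
  by case/exists_inP=> p _; apply: tC.
- apply/setP=> j; rewrite in_set0; apply/negP=> /confinedP[/setDP[Cj jK] h].
  have : j \notin confined t D C set0 by rewrite c0 inE.
  move=> /(confinedPn Cj)[i [b [Di tij _]]]; case: (boolP (i \in P)) => Pi.
    by have := h p0 b (setU11 _ _) (ttp (j, b) i Pi tij jK); rewrite inE.
  have Oi : i \in O by apply/setDP.
  by have := h i b (sO i Oi) (ttO _ _ Oi tij); rewrite inE.
(* The |O| + 1 blocks face |C| - |K| = |O| components. *)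
- by rewrite cardsU1 p0O !cardsD (setIidPr PD) (setIidPr KC) DC PK.
- move=> U /ITP[h1 h2]; have iU : IT t O U.
    apply/ITP; split=> [i Oi|i i' Oi Oi']; first by apply: ttO' => //; apply/h1/sO.
    by apply: h2; apply: sO.
  case/negP: (nbig U iU); have [xK [p Pp tx]] := ttp' _ (h1 p0 (setU11 _ _)).
  apply/exists_inP; exists p => //; apply/existsP; exists (U p0); rewrite tx xK /=.
  by apply/forall_inP=> e Oe; apply/compatibleP; apply: h2; [apply: setU11|apply: sO].
- move=> i /setU1P[->|Oi].
    exists F; rewrite setU1K //; apply: IT_mono iF => i' x Oi'; exact: ttO.
  have [U iU /exists_inP[p Pp /existsP[x /and3P[tx xK /forall_inP h]]]] := minU i Oi.
  exists (upd U p0 x); apply: IT_extend; last first.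
  + move=> i' /setD1P[i'p /setD1P[i'i /setU1P[/eqP e|Oi']]] e'.
      by rewrite e in i'p.
    have /h/compatibleP hc : i' \in O :\ i by rewrite in_setD1 i'i.
    by apply/esym/hc/esym.
  + exact: ttp Pp tx xK.
  have sub : (p0 |: O) :\ i :\ p0 \subset O :\ i.
    apply/subsetP=> i' /setD1P[/negPf i'p]; rewrite !in_setD1 in_setU1 i'p; exact.
  apply: IT_sub sub (IT_mono _ iU) => i' y /setD1P[_]; exact: ttO.
- exact: sO.
- apply/set0Pn; exists p0; rewrite in_setD1 setU11 andbT.
  by apply: contraNneq p0O => ->.
move=> x [/(ttO' _ _ kO) tx h]; exists x; split=> // i Di ti.
have /setDP[kD kP] := kO.
have xK : x.1 \notin K by apply: contraNN kP; apply: K_inner.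
case: (boolP (i \in P)) => Pi.
  by move: p0O; rewrite (h p0 (setU11 _ _) (ttp _ _ Pi ti xK)) kO.
have Oi : i \in O by apply/setDP.
by apply: h; [apply: sO|apply: ttO].
Qed.

End Tight.

Theorem private_of_minimal_disconnected F k : IT t D F ->
  ~ (forall S T, IT t D S -> IT t D T -> connect (reconf t D) S T) -> k \in D ->
  exists x, t k x /\ forall i, i \in D -> t i x -> i = k.
Proof.
move=> iF ndis kD.
case: (boolP [exists x, t k x && [forall i in D, t i x ==> (i == k)]]) => [|npr].
  case/existsP=> x /andP[tx /forall_inP h]; exists x; split=> // i Di ti.
  by apply/eqP; apply: (implyP (h i Di)).
have {}npr x : t k x -> exists w, [/\ w \in D, w <> k & t w x].
  move=> tx; move/existsPn: npr => /(_ x); rewrite tx /= => /forall_inPn[w Dw].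
  by rewrite negb_imply => /andP[tw /eqP wk]; exists w.
pose p (R : {set I}) := [&& R \subset D, R != set0 & #|R| <= #|confined t D C R|].
have [|P [/and3P[PD P0 Pc] Pmin]] := @minimal_tight _ _ t D C p D (fun=> erefl).
  rewrite /p subxx DC subset_leq_card ?andbT; first by apply/set0Pn; exists k.
  by apply/subsetP=> j Cj; apply/confinedP.
set K := confined t D C P in Pc; pose O := D :\: P.
have OD : O \subset D by apply: subsetDl.
have iFO : IT t O F by apply: IT_sub iF.
have [N [iN _]] := inner_IT Pc Pmin F c0.
have nbig U : IT t O U -> ~~ ((#|P| < #|K|) || extra P U O).
  move=> iU; apply/negP=> big; apply: ndis => S T iS iT.
  apply: connect_trans (conn_of_big PD P0 Pc Pmin iU big iN iS) _.
  by rewrite conn_sym; apply: conn_of_big.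
have PK : #|P| = #|K|.
  by apply/eqP; rewrite eqn_leq Pc leqNgt; move: (nbig F iFO); rewrite negb_or => /andP[].
have nex U : IT t O U -> ~~ extra P U O by move/nbig; rewrite negb_or => /andP[].
have nin : ~ inner_conn P.
  by move=> ic; apply: ndis => S T iS iT; apply: conn_of_inner nex _ _ iS iT.
case: (boolP (k \in P)) => kP.
  by case: nin; apply: inner_conn_core npr.
have kO : k \in O by apply/setDP.
(* If the deletion of some outer block never makes a vertex outside [K] available to P, then P is
   connected inside [K], which [nin] excludes; so the collapsed instance gains a transversal at each
   deletion. *)
case: (boolP [forall i in O, [exists U, IT t (O :\ i) U && extra P U (O :\ i)]]).
  move=> /forall_inP h; apply: (outer_private PD P0 PK kO iFO nex) => i /h.
  by case/existsP=> U /andP[iU eU]; exists U.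
case/forall_inPn=> i iO /existsPn h; case: nin.
apply: (inner_conn_outer PD iO iFO) => U iU.
by move: (h U); rewrite iU.
Qed.

End MinimalDisconnected.

(** * Contracting a component with its sides in two blocks *)

Section Contraction.

Variables I J : finType.
Implicit Types (S T : {ffun I -> J * bool}) (x y : J * bool).
Variables (t : I -> J * bool -> bool) (E : {set I}) (u : bool -> I) (w : I) (j0 : J).
Hypotheses (uE : forall c, u c \notin E) (wE : w \notin E).
Hypothesis (utf : u true != u false).
Hypothesis tE : forall i x, i \in E -> t i x -> x.1 != j0.
Hypothesis tw : forall x, t w x = (x.1 != j0) && (t (u true) x || t (u false) x).
Hypothesis tu : forall c d, t (u c) (j0, d) = (d == c).

Let D1 := u true |: (u false |: E).
Let D' := w |: E.

(** Neither side determines the other: T does not record the block that fails to supply [T w], and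
    if both split blocks are off component [j0], either may supply it. The transfers of
    connectedness therefore quantify over all related transversals. *)
Definition over S T :=
  [/\ IT t D1 S, IT t D' T, {in E, S =1 T} & exists c, S (u c) = T w].

Lemma D1P c i : i \in D1 -> [\/ i = u c, i = u (~~ c) | i \in E].
Proof.
case/setU1P=> [->|/setU1P[->|iE]]; last by constructor 3.
  by case: c; [constructor 1|constructor 2].
by case: c; [constructor 2|constructor 1].
Qed.

Lemma uD1 c : u c \in D1.
Proof. by case: c; rewrite !in_setU1 eqxx ?orbT. Qed.

Lemma ED1 i : i \in E -> i \in D1.
Proof. by move=> iE; rewrite !in_setU1 iE !orbT. Qed.

Lemma uN c : u (~~ c) != u c.
Proof. by case: c => //; rewrite eq_sym. Qed.

Lemma Eu i c : i \in E -> i != u c.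
Proof. by move=> iE; apply: contraNneq (uE c) => <-. Qed.

Lemma Ew i : i \in E -> i != w.
Proof. by move=> iE; apply: contraNneq wE => <-. Qed.

(** Both transversals draw their labels from one stock: pairwise compatible labels off [j0], and a
    single side of [j0]. *)
Lemma reconf_of_values (V : J * bool -> Prop) s S T :
  (forall y z, V y -> V z -> y.1 = z.1 -> y = z) -> (forall y, V y -> y.1 != j0) ->
  (forall i, i \in D1 -> t i (S i) /\ (V (S i) \/ S i = (j0, s))) ->
  (forall i, i \in D1 -> t i (T i) /\ (V (T i) \/ T i = (j0, s))) ->
  reconf t D1 S T.
Proof.
move=> V1 V2 hS hT.
have key y z : V y \/ y = (j0, s) -> V z \/ z = (j0, s) -> y.1 = z.1 -> y = z.
  case=> [Vy|->]; case=> [Vz|->] //; first exact: V1.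
    by move=> e; have := V2 y Vy; rewrite e eqxx.
  by move=> e; have := V2 z Vz; rewrite -e eqxx.
apply/reconfP; split.
- apply/ITP; split=> [i /hS[]|i i' /hS[_ h] /hS[_ h']] //; exact: key.
- apply/ITP; split=> [i /hT[]|i i' /hT[_ h] /hT[_ h']] //; exact: key.
- by move=> i i' /hS[_ h] /hT[_ h']; apply: key.
Qed.

(* Blocks [u true] and [u false] contain the two sides of component j0 and are merged
   into w: one of them keeps the vertex of w, the other one uses its side of j0. *)
Definition can c T : {ffun I -> J * bool} :=
  [ffun i => if i == u c then T w else if i == u (~~ c) then (j0, ~~ c) else T i].

Lemma can_u c T : can c T (u c) = T w.
Proof. by rewrite ffunE eqxx. Qed.

Lemma can_uN c T : can c T (u (~~ c)) = (j0, ~~ c).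
Proof. by rewrite ffunE (negPf (uN c)) eqxx. Qed.

Lemma can_E c T i : i \in E -> can c T i = T i.
Proof. by move=> iE; rewrite ffunE !(negPf (Eu _ iE)). Qed.

Lemma ITj T i : IT t D' T -> i \in D' -> (T i).1 != j0.
Proof.
case/ITP=> h _ /[dup] Di /setU1P[iw|iE]; last by apply: tE (h i Di).
by move: (h i Di); rewrite iw tw => /andP[].
Qed.

(** The split block that does not supply [T w] can retreat to its own side of [j0], since the only
    other block touching [j0] is [u c], which stands elsewhere. *)
Lemma over_can c S T : IT t D1 S -> IT t D' T -> {in E, S =1 T} -> S (u c) = T w ->
  reconf t D1 S (can c T).
Proof.
move=> iS iT eE eu; case/ITP: (iS) => h1 h2.
pose V y := (exists2 i, i \in D1 & y = S i) /\ y.1 != j0.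
have VE i : i \in E -> V (S i).
  by move=> iE; split; [exists i => //; apply: ED1|apply: tE (h1 i (ED1 iE))].
have Vu : V (S (u c)).
  by split; [exists (u c) => //; apply: uD1|rewrite eu; apply: ITj => //; apply: setU11].
apply: (reconf_of_values (V := V) (s := ~~ c)).
- by move=> y z [[i Di ->] _] [[i' Di' ->] _]; apply: h2.
- by move=> y [].
- move=> i Di; split; first exact: h1.
  case/(D1P c): (Di) => [->|ei|/VE]; [by left| |by left].
  case: (boolP ((S i).1 == j0)) => [/eqP ej|nj]; last by left; split=> //; exists i.
  right; have := h1 i Di; rewrite ei in ej *.
  by rewrite (surjective_pairing (S _)) ej tu => /eqP->.
- move=> i Di; case/(D1P c): (Di) => [->|->|iE].
  + by rewrite can_u -eu; split; [apply: h1; apply: uD1|left].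
  + by rewrite can_uN tu; split; [|right].
  + by rewrite can_E // -eE //; split; [apply: h1|left; apply: VE].
Qed.

Lemma tw_u T : IT t D' T -> exists c, t (u c) (T w).
Proof.
by case/ITP=> h _; move: (h w (setU11 _ _)); rewrite tw => /andP[_ /orP[]];
  [exists true|exists false].
Qed.

Lemma can_conn c d S T : reconf t D' S T -> t (u c) (S w) -> t (u d) (T w) ->
  connect (reconf t D1) (can c S) (can d T).
Proof.
move=> /reconfP[iS iT cr] tc td; case/ITP: (iS) => s1 s2; case/ITP: (iT) => t1 t2.
have wD : w \in D' by apply: setU11.
have ED i : i \in E -> i \in D' by move=> iE; apply/setU1P; right.
pose V y := exists2 i, i \in D' & y = S i \/ y = T i.
have VS i : i \in D' -> V (S i) by exists i => //; left.
have VT i : i \in D' -> V (T i) by exists i => //; right.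
have V1 y z : V y -> V z -> y.1 = z.1 -> y = z.
  move=> [i Di [->|->]] [i' Di' [->|->]] e; [exact: s2|exact: cr| |exact: t2].
  by apply/esym/cr.
have V2 y : V y -> y.1 != j0 by move=> [i Di [->|->]]; apply: ITj.
have cS i : i \in D1 -> t i (can c S i) /\ (V (can c S i) \/ can c S i = (j0, ~~ c)).
  case/(D1P c)=> [->|->|iE].
  - by rewrite can_u; split=> //; left; apply: VS.
  - by rewrite can_uN tu; split=> //; right.
  - by rewrite can_E //; split; [apply/s1/ED|left; apply/VS/ED].
have cT i : i \in D1 -> t i (can d T i) /\ (V (can d T i) \/ can d T i = (j0, ~~ d)).
  case/(D1P d)=> [->|->|iE].
  - by rewrite can_u; split=> //; left; apply: VT.
  - by rewrite can_uN tu; split=> //; right.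
  - by rewrite can_E //; split; [apply/t1/ED|left; apply/VT/ED].
case: (c =P d) => [e|ne]; first by rewrite -e in cT *; apply/connect1/(reconf_of_values V1 V2 cS cT).
have ed : d = ~~ c by case: (c) (d) ne => [] [].
(* When the block supplying w changes, pass through a transversal off [j0]: one split block still
   holds the old label of w, the other already holds the new one. Either side of [j0] is compatible
   with it. *)
pose m : {ffun I -> J * bool} :=
  [ffun i => if i == u c then S w else if i == u d then T w else T i].
have hm s i : i \in D1 -> t i (m i) /\ (V (m i) \/ m i = (j0, s)).
  rewrite ffunE; case/(D1P c)=> [->|->|iE].
  - by rewrite eqxx; split=> //; left; apply: VS.
  - by rewrite (negPf (uN c)) -ed eqxx; split=> //; left; apply: VT.
  - by rewrite !(negPf (Eu _ iE)); split; [apply/t1/ED|left; apply/VT/ED].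
apply: connect_trans (connect1 (reconf_of_values V1 V2 cS (hm _))) _.
exact/connect1/(reconf_of_values V1 V2 (hm _) cT).
Qed.

Lemma over_conn S S' T T' : over S S' -> over T T' -> reconf t D' S' T' ->
  connect (reconf t D1) S T.
Proof.
move=> [iS iS' eS [c ec]] [iT iT' eT [d ed]] m.
apply: connect_trans (connect1 (over_can iS iS' eS ec)) _.
rewrite conn_sym; apply: connect_trans (connect1 (over_can iT iT' eT ed)) _.
rewrite conn_sym; apply: can_conn => //.
  by rewrite -ec; case/ITP: iS => h _; apply/h/uD1.
by rewrite -ed; case/ITP: iT => h _; apply/h/uD1.
Qed.

(** Every label of a merged transversal already occurs in the split one, so compatibility is
    inherited. *)
Lemma over_reconf S S' T T' : over S S' -> over T T' -> reconf t D1 S T -> reconf t D' S' T'.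
Proof.
have lab S1 S1' i : over S1 S1' -> i \in D' -> exists2 i', i' \in D1 & S1' i = S1 i'.
  move=> [_ _ e [c ec]] /setU1P[->|iE]; first by exists (u c); rewrite ?uD1.
  by exists i; [apply: ED1|rewrite e].
move=> oS oT /reconfP[_ _ h]; have [_ iS' _ _] := oS; have [_ iT' _ _] := oT.
apply/reconfP; split=> // i i' /(lab _ _ _ oS)[k Dk ->] /(lab _ _ _ oT)[k' Dk' ->].
exact: h.
Qed.

Lemma over_up T : IT t D' T -> exists S, over S T.
Proof.
move=> iT; have [c tc] := tw_u iT; exists (can c T); split=> //; last first.
- by exists c; rewrite can_u.
- by move=> i; apply: can_E.
have m : reconf t D' T T by apply: reconf_eq.
case/ITP: (iT) => h1 h2; have ED i : i \in E -> i \in D' by move=> iE; apply/setU1P; right.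
suff: reconf t D1 (can c T) (can c T) by case/reconfP.
apply: (reconf_of_values (V := fun y => exists2 i, i \in D' & y = T i) (s := ~~ c)).
- by move=> y z [i Di ->] [i' Di' ->]; apply: h2.
- by move=> y [i Di ->]; apply: ITj.
all: move=> i /(D1P c)[->|->|iE].
all: try by rewrite can_u; split=> //; left; exists w; rewrite ?setU11.
all: try by rewrite can_uN tu; split=> //; right.
all: by rewrite can_E //; split; [apply/h1/ED|left; exists i => //; apply: ED].
Qed.

(** The split blocks own opposite sides of [j0] and cannot both stand there; one that is off [j0]
    supplies the label of w. *)
Lemma over_down S : IT t D1 S -> exists T, over S T.
Proof.
move=> iS; case/ITP: (iS) => h1 h2.
have [c nc]: exists c, (S (u c)).1 != j0.
  case: (boolP ((S (u true)).1 == j0)) => [/eqP e1|]; last by exists true.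
  case: (boolP ((S (u false)).1 == j0)) => [/eqP e2|]; last by exists false.
  have e := h2 _ _ (uD1 true) (uD1 false) (etrans e1 (esym e2)).
  have := h1 _ (uD1 true); have := h1 _ (uD1 false); rewrite -e.
  by rewrite (surjective_pairing (S _)) e1 !tu => /eqP->.
have tS := h1 _ (uD1 c).
exists (upd S w (S (u c))); split=> //; last first.
- by exists c; rewrite updE.
- by move=> i iE; rewrite updN //; apply: Ew.
apply: IT_extend; last 2 first.
- by rewrite tw nc; case: (c) tS => ->; rewrite ?orbT.
- move=> i; rewrite setU1K // => iE e; apply: h2 => //; [exact: ED1|exact: uD1].
by rewrite setU1K //; apply: IT_sub iS; apply/subsetP=> i; apply: ED1.
Qed.

Lemma contract_IT : (exists S, IT t D1 S) -> exists T, IT t D' T.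
Proof. by case=> S /over_down[T [_ iT _ _]]; exists T. Qed.

Lemma expand_conn :
  (forall S T, IT t D' S -> IT t D' T -> connect (reconf t D') S T) ->
  forall S T, IT t D1 S -> IT t D1 T -> connect (reconf t D1) S T.
Proof.
move=> h S T /over_down[S' oS] /over_down[T' oT].
have [iS iS' _ _] := oS; have [_ iT' _ _] := oT.
suff [_]: IT t D' T' /\ (forall U, over U T' -> connect (reconf t D1) S U) by apply.
apply: (connect_inv (Q := fun T' => IT t D' T' /\
  forall U, over U T' -> connect (reconf t D1) S U)) (h S' T' iS' iT') => [X Y [iX hX] m|].
  split; first by case/reconfP: m.
  move=> U oU; have [U' oU'] := over_up iX.
  exact: connect_trans (hX U' oU') (over_conn oU' oU m).
by split=> // U oU; apply: over_conn oS oU _; apply: reconf_eq.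
Qed.

Lemma contract_conn :
  (forall S T, IT t D1 S -> IT t D1 T -> connect (reconf t D1) S T) ->
  forall S T, IT t D' S -> IT t D' T -> connect (reconf t D') S T.
Proof.
move=> h S' T' /over_up[S oS] /over_up[T oT].
have [iS iS' _ _] := oS; have [iT _ _ _] := oT.
suff [_]: IT t D1 T /\ (forall U, over T U -> connect (reconf t D') S' U) by apply.
apply: (connect_inv (Q := fun T => IT t D1 T /\
  forall U, over T U -> connect (reconf t D') S' U)) (h S T iS iT) => [X Y [iX hX] m|].
  split; first by case/reconfP: m.
  move=> U oU; have [U' oU'] := over_down iX.
  exact: connect_trans (hX U' oU') (connect1 (over_reconf oU' oU m)).
by split=> // U oU; apply/connect1/(over_reconf oS oU)/reconf_eq.
Qed.

(** Deleting the merged block is compared with deleting one split block: the other one can rest on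
    its side of [j0], in conflict with no block of [E]. *)
Lemma contract_del_conn c :
  (forall S T, IT t (u c |: E) S -> IT t (u c |: E) T ->
     connect (reconf t (u c |: E)) S T) ->
  forall S T, IT t E S -> IT t E T -> connect (reconf t E) S T.
Proof.
move=> h S T iS iT.
have ext U : IT t E U -> IT t (u c |: E) (upd U (u c) (j0, c)).
  move=> iU; apply: IT_extend; rewrite ?setU1K ?tu // => i iE e.
  by case/ITP: iU => hU _; have := tE iE (hU i iE); rewrite e eqxx.
have sE : E \subset u c |: E by apply: subsetUr.
have cST := conn_sub sE (h _ _ (ext S iS) (ext T iT)).
have up U i : i \in E -> upd U (u c) (j0, c) i = U i by move=> iE; rewrite updN // Eu.
apply: connect_trans (connect_trans cST _); apply: connect1.
  by apply: reconf_eq => // i iE; rewrite up.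
by rewrite reconf_sym; apply: reconf_eq => // i iE; rewrite up.
Qed.

End Contraction.

(** * From graphs to labels *)

Section Labels.

Variables (T : finType) (n : nat) (A B : 'I_n -> {set T}) (x0 : 'I_n * bool).
Implicit Types (G : graph T) (U : {set {set T}}) (S W : {set T}) (x y : 'I_n * bool)
  (F : {ffun {set T} -> 'I_n * bool}).

Definition side x : {set T} := if x.2 then A x.1 else B x.1.

(** It depends on the single block W, so deleting another block changes only the index set of blocks
    and leaves the labels alone. *)
Definition touch W x : bool := side x :&: W != set0.

Definition lab v : 'I_n * bool := odflt x0 [pick x | v \in side x].

(** Deleting a block may empty a part of a component, so the bipartite structure is replaced by this
    criterion for independence, which survives deletion with the same labels. *)
Definition represents G :=
  (forall v, v \in vset G -> v \in side (lab v)) /\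
  (forall S, S \subset vset G ->
     (independent G S <->
      forall v v', v \in S -> v' \in S -> (lab v).1 = (lab v').1 -> lab v = lab v')).

Hypothesis sides_disjoint : forall v x y, v \in side x -> v \in side y -> x = y.

Lemma lab_side v x : v \in side x -> lab v = x.
Proof.
move=> vx; rewrite /lab; case: pickP => [y vy|/(_ x)]; last by rewrite vx.
exact: sides_disjoint vy vx.
Qed.

Lemma touchP W x : reflect (exists2 v, v \in W & v \in side x) (touch W x).
Proof.
rewrite /touch; apply: (iffP (set0Pn _)) => -[v]; first by case/setIP; exists v.
by move=> vW vx; exists v; apply/setIP.
Qed.

Lemma independent_sub G S S' : S' \subset S -> independent G S -> independent G S'.
Proof.
move=> sub /andP[SV /forall_inP h]; apply/andP; split; first exact: subset_trans sub SV.
by apply/forall_inP=> e /h; apply: contraNN => eS; apply: subset_trans eS sub.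
Qed.

Section Instance.

Variables (G : graph T) (U : {set {set T}}).
Hypotheses (pU : partition U (vset G)) (rG : represents G).

Lemma block_uniq W W' v : W \in U -> W' \in U -> v \in W -> v \in W' -> W = W'.
Proof.
case/and3P: pU => _ tU _ UW UW' vW vW'.
by rewrite -(def_pblock tU UW vW) (def_pblock tU UW' vW').
Qed.

Lemma block_sub W : W \in U -> W \subset vset G.
Proof. by case/and3P: pU => /eqP<- _ _ UW; apply: bigcup_sup UW. Qed.

Lemma in_block v : v \in vset G -> exists2 W, W \in U & v \in W.
Proof. by case/and3P: pU => /eqP<- _ _ /bigcupP[W]; exists W. Qed.

Lemma is_ITP S : is_IT G U S -> [/\ independent G S, S \subset vset G &
  forall W, W \in U -> exists v, [/\ v \in S, v \in W &
    forall v', v' \in S -> v' \in W -> v' = v]].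
Proof.
case/andP=> iS /forall_inP h; split=> //; first by case/andP: iS.
move=> W /h/cards1P[v ev]; have : v \in S :&: W by rewrite ev set11.
case/setIP=> vS vW; exists v; split=> // v' v'S v'W.
by apply/set1P; rewrite -ev; apply/setIP.
Qed.

Lemma ITI S : independent G S ->
  (forall W, W \in U -> exists v, [/\ v \in S, v \in W &
    forall v', v' \in S -> v' \in W -> v' = v]) -> is_IT G U S.
Proof.
move=> iS h; apply/andP; split=> //; apply/forall_inP=> W /h[v [vS vW hv]].
apply/cards1P; exists v; apply/setP=> v'; rewrite in_setI in_set1.
apply/andP/eqP => [[]|->] //; exact: hv.
Qed.

Lemma IT_card S : is_IT G U S -> #|S| = #|U|.
Proof.
move=> /is_ITP[_ SV h].
have tU : trivIset U by case/and3P: pU.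
have -> : U = [set pblock U v | v in S].
  apply/setP=> W; apply/idP/imsetP => [UW|[v vS ->]].
    by have [v [vS vW _]] := h W UW; exists v => //; rewrite (def_pblock tU UW vW).
  have [W' UW' vW'] := in_block (subsetP SV _ vS).
  by rewrite (def_pblock tU UW' vW').
rewrite card_in_imset // => v v' vS v'S.
have [W UW vW] := in_block (subsetP SV _ vS).
have [W' UW' vW'] := in_block (subsetP SV _ v'S).
rewrite (def_pblock tU UW vW) (def_pblock tU UW' vW') => eW.
have [u [_ _ hu]] := h W UW; rewrite (hu v vS vW).
by apply/esym/hu; rewrite ?eW.
Qed.

(** Exchange a vertex of S outside S' for the vertex of S' in the same block. Everything stays
    inside the independent set [S :|: S'], and [S :\: S'] shrinks. *)
Lemma union_conn S S' : is_IT G U S -> is_IT G U S' -> independent G (S :|: S') ->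
  connect (RG_adj G U) S S'.
Proof.
elim: {S}#|S :\: S'| {-2}S (leqnn #|S :\: S'|) => [|m IH] S.
  rewrite leqn0 cards_eq0 setD_eq0 => SS' iS iS' _.
  have -> : S = S' by apply/eqP; rewrite eqEcard SS' (IT_card iS) (IT_card iS') leqnn.
  exact: connect0.
move=> cS iS iS' iSS; case: (set_0Vmem (S :\: S')) => [e|[v /setDP[vS vS']]].
  by apply: IH; rewrite ?e ?cards0.
have [_ SV hS] := is_ITP iS; have [_ SV' hS'] := is_ITP iS'.
have [W UW vW] := in_block (subsetP SV _ vS).
have [v' [v'S' v'W hv']] := hS' W UW.
have [u [_ _ hu]] := hS W UW.
have v'S : v' \notin S.
  by apply: contraNN vS' => v'S; rewrite (hu v) // -(hu v').
pose S2 := v' |: (S :\ v).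
have S2sub : S2 \subset S :|: S'.
  apply/subsetP=> z /setU1P[->|/setD1P[_ zS]]; apply/setUP; by [right|left].
have iS2 : is_IT G U S2.
  apply: ITI; first exact: independent_sub S2sub iSS.
  move=> W' UW'; case: (W' =P W) => [->|ne].
    exists v'; split=> //; first exact: setU11.
    move=> z /setU1P[//|/setD1P[zv zS]] zW.
    by case/eqP: zv; rewrite (hu z) // (hu v).
  have [z [zS zW hz]] := hS W' UW'; exists z; split=> //.
    apply/setU1P; right; rewrite in_setD1 zS andbT; apply/eqP=> zv.
    by case: ne; apply: (block_uniq UW' UW (v := v)) => //; rewrite -zv.
  move=> z' /setU1P[->|/setD1P[_ z'S]] z'W; last exact: hz.
  by case: ne; apply: (block_uniq UW' UW z'W).
have SS2 : S :|: S2 = v' |: S.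
  apply/setP=> z; rewrite !in_setU !in_set1 in_setD1.
  by case: (z \in S); rewrite ?orbT ?andbF ?orbF.
have a : RG_adj G U S S2.
  apply/and4P; split=> //; last by rewrite SS2 cardsU1 v'S IT_card.
  by apply: independent_sub iSS; rewrite subUset subsetUl.
apply: connect_trans (connect1 a) (IH _ _ iS2 iS' _).
  rewrite -ltnS; apply: leq_trans cS; apply/proper_card/properP; split.
    apply/subsetP=> z /setDP[/setU1P[->|/setD1P[_ zS]] zS']; first by rewrite v'S' in zS'.
    exact/setDP.
  exists v; first exact/setDP.
  rewrite in_setD vS' /= in_setU1 in_setD1 eqxx orbF; apply/eqP=> e.
  by rewrite e v'S' in vS'.
by apply: independent_sub iSS; rewrite subUset S2sub subsetUr.
Qed.

Definition abs S : {ffun {set T} -> 'I_n * bool} :=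
  [ffun W : {set T} => if [pick v in S :&: W] is Some v then lab v else x0].

Lemma absE S W v : is_IT G U S -> W \in U -> v \in S -> v \in W -> abs S W = lab v.
Proof.
move=> /is_ITP[_ _ h] UW vS vW; have [u [_ _ hu]] := h W UW; rewrite ffunE.
case: pickP => [z /setIP[zS zW]|/(_ v)]; last by rewrite in_setI vS vW.
by rewrite (hu z) // (hu v).
Qed.

Lemma abs_union S S' : is_IT G U S -> is_IT G U S' -> independent G (S :|: S') ->
  reconf touch U (abs S) (abs S').
Proof.
have main R R' : is_IT G U R -> is_IT G U R' -> independent G (R :|: R') ->
    forall W W', W \in U -> W' \in U -> (abs R W).1 = (abs R' W').1 ->
    abs R W = abs R' W'.
  move=> iR iR' iRR W W' UW UW'; have [_ RV h] := is_ITP iR; have [_ RV' h'] := is_ITP iR'.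
  have [v [vR vW _]] := h W UW; have [v' [vR' vW' _]] := h' W' UW'.
  rewrite (absE iR UW vR vW) (absE iR' UW' vR' vW').
  have RRV : R :|: R' \subset vset G by rewrite subUset RV.
  by apply: (proj1 (proj2 rG _ RRV) iRR); apply/setUP; [left|right].
have abs_IT R : is_IT G U R -> IT touch U (abs R).
  move=> iR; have [indR RV h] := is_ITP iR; apply/ITP; split=> [W UW|].
    have [v [vR vW _]] := h W UW; rewrite (absE iR UW vR vW); apply/touchP; exists v => //.
    by apply: (proj1 rG); apply: (subsetP RV).
  by apply: main => //; rewrite setUid.
by move=> iS iS' iSS; apply/reconfP; split; [exact: abs_IT|exact: abs_IT|exact: main].
Qed.

Lemma abs_IT S : is_IT G U S -> IT touch U (abs S).
Proof.
move=> iS; have [indS _ _] := is_ITP iS.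
by have /reconfP[] : reconf touch U (abs S) (abs S) by apply: abs_union; rewrite ?setUid.
Qed.

Lemma realize F : IT touch U F -> exists S, [/\ is_IT G U S, {in U, abs S =1 F}
  & forall v, v \in S -> exists2 W, W \in U & lab v = F W].
Proof.
move=> /ITP[h1 h2].
pose pk W := [pick v in side (F W) :&: W].
have pkP W : W \in U -> exists v, [/\ pk W = Some v, v \in W & lab v = F W].
  move=> UW; have /touchP[v vW vs] := h1 W UW; rewrite /pk.
  case: pickP => [z /setIP[zs zW]|/(_ v)]; last by rewrite in_setI vs vW.
  by exists z; rewrite (lab_side zs).
pose S := [set v | [exists W in U, pk W == Some v]].
have SP v : v \in S -> exists2 W, W \in U & v \in W /\ lab v = F W /\ pk W = Some v.
  rewrite inE => /exists_inP[W UW /eqP e]; exists W => //.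
  by have [z []] := pkP W UW; rewrite e => -[<-].
have indS : independent G S.
  have SV : S \subset vset G.
    by apply/subsetP=> v /SP[W UW [vW _]]; apply: (subsetP (block_sub UW)).
  apply/(proj2 rG _ SV) => v v' /SP[W UW [_ [-> _]]] /SP[W' UW' [_ [-> _]]].
  exact: h2.
have iS : is_IT G U S.
  apply: ITI => // W UW; have [v [e vW lv]] := pkP W UW; exists v; split=> //.
    by rewrite inE; apply/exists_inP; exists W; rewrite ?e.
  move=> v' /SP[W' UW' [vW' [_ e']]] v'W.
  by move: e'; rewrite -(block_uniq UW UW' v'W vW') e => -[].
exists S; split=> //; last by move=> v /SP[W UW [_ [e _]]]; exists W.
move=> W UW; have [v [e vW lv]] := pkP W UW; rewrite -lv; apply: absE => //.
by rewrite inE; apply/exists_inP; exists W; rewrite ?e.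
Qed.

Lemma reconf_union_conn S S' : is_IT G U S -> is_IT G U S' ->
  reconf touch U (abs S) (abs S') -> connect (RG_adj G U) S S'.
Proof.
move=> iS iS' /reconfP[/ITP[_ s] /ITP[_ s'] h]; apply: union_conn => //.
have [_ SV _] := is_ITP iS; have [_ SV' _] := is_ITP iS'.
have SS : S :|: S' \subset vset G by rewrite subUset SV.
apply/(proj2 rG _ SS).
have blk R v : is_IT G U R -> v \in R -> exists2 W, W \in U & abs R W = lab v.
  move=> iR vR; have [_ RV _] := is_ITP iR.
  have [W UW vW] := in_block (subsetP RV _ vR); exists W => //; exact: absE.
move=> v v' /setUP[/(blk _ _ iS)|/(blk _ _ iS')] [W UW <-] /setUP[/(blk _ _ iS)|/(blk _ _ iS')] [W' UW' <-].
- exact: s.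
- exact: h.
- by move=> e; apply/esym/h.
- exact: s'.
Qed.

Lemma RG_connectedP : RG_connected G U <->
  forall F F', IT touch U F -> IT touch U F' -> connect (reconf touch U) F F'.
Proof.
split=> [h F F' iF iF'|h S S' iS iS'].
  have [S [iS eS _]] := realize iF; have [S' [iS' eS' _]] := realize iF'.
  have c : connect (reconf touch U) (abs S) (abs S').
    apply: (connect_inv (Q := fun R => connect _ _ (abs R))) (h S S' iS iS').
      move=> R R' c /and4P[iR iR' iRR _]; apply: connect_trans c (connect1 _).
      exact: abs_union.
    exact: connect0.
  apply: connect_trans (connect_trans c _); apply: connect1.
    by rewrite reconf_sym; apply: reconf_eq (abs_IT iS).
  exact: reconf_eq (abs_IT iS').
(* Different transversals may carry the same labels, so the invariant speaks of every R labelled by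
   F. *)
pose Q F := IT touch U F /\ forall R, is_IT G U R -> {in U, abs R =1 F} ->
  connect (RG_adj G U) S R.
suff [_]: Q (abs S') by apply.
apply: (connect_inv (Q := Q)) (h _ _ (abs_IT iS) (abs_IT iS')); last first.
  split; first exact: abs_IT.
  move=> R iR eR; apply: reconf_union_conn => //; rewrite reconf_sym.
  exact: reconf_eq eR (abs_IT iR).
move=> F F' [iF hF] m; have /reconfP[_ iF' cr] := m; split=> // R iR eR.
have [R1 [iR1 eR1 _]] := realize iF.
apply: connect_trans (hF R1 iR1 eR1) _; apply: reconf_union_conn => //.
apply/reconfP; split; try exact: abs_IT.
by move=> W W' UW UW'; rewrite eR1 // eR //; apply: cr.
Qed.

Lemma RG_nonemptyP : RG_nonempty G U <-> exists F, IT touch U F.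
Proof.
split=> [[S /abs_IT iS]|[F /realize[S []]]]; first by exists (abs S).
by exists S.
Qed.

End Instance.

Lemma partition_del G U W : partition U (vset G) -> W \in U ->
  partition (U :\ W) (vset (del_vertices G W)).
Proof.
move=> pU UW; case/and3P: (pU) => /eqP cU tU U0; apply/and3P; split.
- rewrite /= -cU; apply/eqP/setP=> v; rewrite in_setD; apply/bigcupP/andP.
    case=> W' /setD1P[ne UW'] vW'; split; last by apply/bigcupP; exists W'.
    by apply: contraNN ne => vW; apply/eqP; apply: (block_uniq pU UW' UW vW' vW).
  case=> vW /bigcupP[W' UW' vW']; exists W' => //; rewrite in_setD1 UW' andbT.
  by apply: contraNneq vW => <-.
- exact: trivIsetS (subD1set _ _) tU.
- by apply: contraNN U0 => /setD1P[].
Qed.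

Lemma represents_del G W : represents G -> represents (del_vertices G W).
Proof.
move=> [r1 r2]; split=> [v /setDP[vG _]|S SV]; first exact: r1.
have SG : S \subset vset G by apply: subset_trans SV (subsetDl _ _).
suff -> : independent (del_vertices G W) S = independent G S by apply: r2.
rewrite /independent SV SG /=; apply/forall_inP/forall_inP => h e.
  move=> eG; case: (boolP [disjoint e & W]) => [eW|]; first by apply: h; rewrite inE eG.
  apply: contraNN => eS; rewrite disjoints_subset; apply: subset_trans eS _.
  by apply: subset_trans SV _; apply/subsetP=> v /setDP[_]; rewrite in_setC.
by rewrite inE => /andP[/h].
Qed.

End Labels.

(** * Disjoint unions of complete bipartite graphs *)

Section Family.

Variables (T : finType) (n : nat) (A B : 'I_n -> {set T}).
Implicit Types (G : graph T) (S : {set T}) (x y : 'I_n * bool) (R : {set 'I_n}).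

(** A component is dropped by shrinking R while the index type stays ['I_n], so an instance and its
    contraction share their labels. *)
Definition subfamily R : graph T :=
  Graph (\bigcup_(i in R) (A i :|: B i))
        (\bigcup_(i in R) edges (complete_bipartite (A i) (B i))).

Lemma big_graph_unionE :
  \big[@graph_union T/Graph set0 set0]_(i < n) complete_bipartite (A i) (B i) =
  subfamily setT.
Proof.
set G := \big[_/_]_(i < n) _.
have eV : vset G = \bigcup_(i in [set: 'I_n]) (A i :|: B i).
  rewrite /G (big_morph (@vset T) (id1 := set0) (op1 := @setU T)) //.
  by apply: eq_bigl => i; rewrite inE.
have eE : edges G = \bigcup_(i in [set: 'I_n]) edges (complete_bipartite (A i) (B i)).
  rewrite /G (big_morph (@edges T) (id1 := set0) (op1 := @setU _)) //.
  by apply: eq_bigl => i; rewrite inE.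
by rewrite /subfamily -eV -eE; case: (G).
Qed.

Hypothesis parts : forall i, bipartition_parts (A i) (B i).
Hypothesis indep : forall i j, i != j -> [disjoint A i :|: B i & A j :|: B j].

Lemma side_sub x : side A B x \subset A x.1 :|: B x.1.
Proof. by rewrite /side; case: x.2; rewrite ?subsetUl ?subsetUr. Qed.

Lemma side_inhab x : exists v, v \in side A B x.
Proof.
by apply/set0Pn; case: x => i [] /=; rewrite /side /=; case: (parts i).
Qed.

Lemma sides_disjoint v x y : v \in side A B x -> v \in side A B y -> x = y.
Proof.
move=> vx vy; have e1 : x.1 = y.1.
  apply/eqP/negPn/negP => /indep/disjoint_setI0 e.
  have: v \in set0 by rewrite -e; apply/setIP; split; [apply: (subsetP (side_sub x))|
    apply: (subsetP (side_sub y))].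
  by rewrite inE.
case: x y e1 vx vy => i b [j c] /= <-; rewrite /side /=.
have [_ _ /disjoint_setI0 e] := parts i.
case: b c => [] [] // h1 h2; have: v \in A i :&: B i by [apply/setIP].
all: by rewrite e inE.
Qed.

Lemma subfamily_vset R v : v \in vset (subfamily R) <->
  exists2 x, x.1 \in R & v \in side A B x.
Proof.
split=> [/bigcupP[i iR /setUP[]]|[x xR vx]].
- by exists (i, true).
- by exists (i, false).
- by apply/bigcupP; exists x.1 => //; apply: (subsetP (side_sub x)).
Qed.

Lemma subfamily_edge R e : e \in edges (subfamily R) <->
  exists i a b, [/\ i \in R, a \in A i, b \in B i & e = [set a; b]].
Proof.
split=> [/bigcupP[i iR /imset2P[a b aA bB ->]]|[i [a [b [iR aA bB ->]]]]].
  by exists i, a, b.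
by apply/bigcupP; exists i => //; apply/imset2P; exists a b.
Qed.

Variable x0 : 'I_n * bool.
Let lab := lab A B x0.
Let lab_side := lab_side x0 sides_disjoint.

Lemma subfamily_represents R : represents A B x0 (subfamily R).
Proof.
have hV v : v \in vset (subfamily R) -> (lab v).1 \in R /\ v \in side A B (lab v).
  by move=> /subfamily_vset[x xR vx]; rewrite /lab (lab_side vx).
split=> [v /hV[]//|S SV]; split=> [/andP[_ /forall_inP h] v v' vS v'S e1|h].
  apply/eqP/negPn/negP => ne.
  have [vR vs] := hV v (subsetP SV _ vS); have [_ vs'] := hV v' (subsetP SV _ v'S).
  move: e1 ne vR vs vs'; rewrite -/lab; case: (lab v) (lab v') => i b [j c] /= <- ne iR.
  have nS : forall a b', a \in S -> b' \in S -> a \in A i -> b' \in B i -> False.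
    move=> a b' aS bS aA bB; have: [set a; b'] \in edges (subfamily R).
      by apply/subfamily_edge; exists i, a, b'.
    by move/h; rewrite subUset !sub1set aS bS.
  rewrite xpair_eqE eqxx /= in ne; rewrite /side /=; case: b c ne => [] [] // _.
    by move=> vA vB; apply: (nS v v').
  by move=> vB vA; apply: (nS v' v).
apply/andP; split=> //; apply/forall_inP=> e /subfamily_edge[i [a [b [iR aA bB ->]]]].
rewrite subUset !sub1set; apply/negP=> /andP[aS bS].
have la : lab a = (i, true) by apply: lab_side.
have lb : lab b = (i, false) by apply: lab_side.
by have := h a b aS bS; rewrite -/lab la lb => /(_ erefl).
Qed.

(** Edges preserve the component index, and vertices of equal index are joined directly or through
    the nonempty opposite part; so the roots of the connected classes correspond to the indices. *)
Lemma num_components_family : num_components (subfamily setT) = n.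
Proof.
set G := subfamily setT; pose e := adj G.
have e_sym : connect_sym e.
  by apply: sym_connect_sym => x y; rewrite /e /adj /= setUC.
have edge i a b : a \in A i -> b \in B i -> e a b.
  by move=> aA bB; apply/subfamily_edge; exists i, a, b; rewrite inE.
have inv a v : connect e a v -> a \in vset G -> v \in vset G /\ (lab v).1 = (lab a).1.
  move=> + aV; apply: (connect_inv (Q := fun v => v \in vset G /\ (lab v).1 = (lab a).1)) => //.
  move=> v1 v2 [_ <-] /subfamily_edge[i [a1 [b1 [_ aA bB e12]]]].
  have la : lab a1 = (i, true) by apply: lab_side.
  have lb : lab b1 = (i, false) by apply: lab_side.
  have h z : z \in [set v1; v2] -> z \in vset G /\ (lab z).1 = i.
    rewrite e12 => /set2P[->|->]; rewrite ?la ?lb; split=> //.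
      by apply/subfamily_vset; exists (i, true); rewrite ?inE.
    by apply/subfamily_vset; exists (i, false); rewrite ?inE.
  have [_ ->] := h v1 (set21 _ _); exact: h v2 (set22 _ _).
have same v v' : v \in vset G -> v' \in vset G -> (lab v).1 = (lab v').1 -> connect e v v'.
  move=> /subfamily_vset[x _ vx] /subfamily_vset[y _ vy]; rewrite /lab !(lab_side vx) (lab_side vy).
  case: x y vx vy => i b [j c] /= vx vy eij; move: eij vy => <- vy.
  have [/= a aA] := side_inhab (i, true); have [/= b' bB] := side_inhab (i, false).
  move: vx vy aA bB; rewrite /side /=; case: b; case: c => vx vy aA bB.
  - by apply: connect_trans (connect1 (edge i v b' vx bB)) _; rewrite e_sym; apply/connect1/(edge i).
  - exact/connect1/(edge i).
  - by rewrite e_sym; apply/connect1/(edge i).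
  - by rewrite e_sym; apply: connect_trans (_ : connect e v' a) _;
      [rewrite e_sym|]; apply/connect1/(edge i).
pose K := [set v | roots e v & v \in vset G].
have -> : num_components G = #|K|.
  by apply: eq_card => v; rewrite !inE.
have inK : {in K &, injective (fun v => (lab v).1)}.
  move=> v v' /setIdP[/eqP rv vV] /setIdP[/eqP rv' v'V] /= ll.
  by rewrite -rv -rv'; apply/eqP; rewrite root_connect //; apply: same.
rewrite -(card_in_imset inK) -[RHS]card_ord -cardsT; congr #|pred_of_set _|.
apply/setP=> i; rewrite inE; apply/imsetP.
have [a aA] := side_inhab (i, true).
have aV : a \in vset G by apply/subfamily_vset; exists (i, true); rewrite ?inE.
have [rV er] := inv a (root e a) (connect_root e a) aV.
exists (root e a); last by rewrite er /lab (lab_side aA).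
by rewrite inE rV andbT roots_root.
Qed.

End Family.

(** * The structure theorem *)

Section Structure.

Variable T : finType.
Implicit Types (G : graph T) (U : {set {set T}}) (W : {set T}).

Section Step.

Variables (n : nat) (A B : 'I_n.+1 -> {set T}).
Hypothesis parts : forall i, bipartition_parts (A i) (B i).
Hypothesis indep : forall i j, i != j -> [disjoint A i :|: B i & A j :|: B j].
Let G := subfamily A B setT.
Variable U : {set {set T}}.
Hypotheses (pU : partition U (vset G)) (cU : #|U| = n.+1) (mU : minimally_RGD G U).
Let x0 : 'I_n.+1 * bool := (ord0, true).
Let t := touch A B.
Let sd := sides_disjoint parts indep.

Lemma side_vset x : side A B x \subset vset G.
Proof. by apply/subsetP=> v vx; apply/subfamily_vset; exists x; rewrite ?inE. Qed.

Lemma del_conn W : W \in U -> forall F F', IT t (U :\ W) F -> IT t (U :\ W) F' ->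
  connect (reconf t (U :\ W)) F F'.
Proof.
move=> UW; have [_ _ h] := mU.
apply/(RG_connectedP sd (partition_del pU UW) (represents_del W (subfamily_represents parts indep x0 setT))).
exact: h.
Qed.

Lemma full_conn : ~ (forall F F', IT t U F -> IT t U F' -> connect (reconf t U) F F').
Proof.
have [_ h _] := mU => hc; apply: h.
exact/(RG_connectedP sd pU (subfamily_represents parts indep x0 setT)).
Qed.

Lemma some_IT : exists F, IT t U F.
Proof.
have [h _ _] := mU.
exact/(RG_nonemptyP sd pU (subfamily_represents parts indep x0 setT)).
Qed.

Lemma block_contains_side W : W \in U -> exists x, side A B x \subset W.
Proof.
move=> UW; have [F iF] := some_IT.
have DC : #|U| = #|[set: 'I_n.+1]| by rewrite cU cardsT card_ord.
have c0 : confined t U setT set0 = set0.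
  apply/setP=> j; rewrite in_set0; apply/negP=> /confinedP[_ h].
  have [v vj] := side_inhab parts (j, true).
  have [W' UW' vW'] := in_block pU (subsetP (side_vset _) _ vj).
  have tW' : t W' (j, true) by apply/touchP; exists v.
  by have := h W' true UW' tW'; rewrite inE.
have [x [_ h]] := private_of_minimal_disconnected (fun i x _ => in_setT x.1) DC c0
  (fun i S S' Ui => del_conn Ui (F := S) (F' := S')) iF full_conn UW.
(* The blocks cover G and only W touches side x, so the whole side lies in W. *)
exists x; apply/subsetP=> v vx.
have [W' UW' vW'] := in_block pU (subsetP (side_vset x) _ vx).
by rewrite -(h W' UW') //; apply/touchP; exists v.
Qed.

(** * Undoing one split *)

Section Contractible.

Variables (W1 W2 : {set T}) (j0 : 'I_n.+1).
Hypotheses (UW1 : W1 \in U) (UW2 : W2 \in U) (W12 : W1 != W2).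
Hypotheses (AW : A j0 \subset W1) (BW : B j0 \subset W2).
Let u (c : bool) := if c then W1 else W2.
Let X := W1 :\: A j0.
Let Y := W2 :\: B j0.
Let W := X :|: Y.
Let E := U :\ W1 :\ W2.
Let G' := subfamily A B [set~ j0].
Let U' := W |: E.

Lemma uU c : u c \in U. Proof. by case: c. Qed.

Lemma side_u c : side A B (j0, c) \subset u c.
Proof. by case: c. Qed.

Lemma u_uniq c v : v \in side A B (j0, c) -> forall W', W' \in U -> v \in W' -> W' = u c.
Proof.
by move=> vs W' UW' vW'; apply: (block_uniq pU UW' (uU c) vW'); apply: (subsetP (side_u c)).
Qed.

Lemma EP W' : reflect [/\ W' \in U, W' <> W1 & W' <> W2] (W' \in E).
Proof.
rewrite !in_setD1; apply: (iffP and3P) => -[].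
  by move=> /eqP h2 /eqP h1 h.
by move=> h /eqP h1 /eqP h2.
Qed.

Lemma U_E : U = W1 |: (W2 |: E).
Proof.
apply/setP=> W'; rewrite !in_setU1 !in_setD1.
case: eqP => [->|ne1] /=; first by rewrite UW1.
by case: eqP => [->|ne2] //=.
Qed.

Lemma WP v : reflect ((v \in W1 \/ v \in W2) /\ (v \notin A j0 :|: B j0)) (v \in W).
Proof.
have dAB : A j0 :&: W2 = set0.
  apply/setP=> z; rewrite in_set0; apply/negP=> /setIP[zA z2]; case/eqP: W12.
  by symmetry; apply: (u_uniq (c := true) zA).
have dBA : B j0 :&: W1 = set0.
  apply/setP=> z; rewrite in_set0; apply/negP=> /setIP[zB z1]; case/eqP: W12.
  by apply: (u_uniq (c := false) zB).
apply: (iffP setUP) => [[/setDP[h1 h2]|/setDP[h1 h2]]|[h]].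
- split; first by left.
  rewrite in_setU (negPf h2) /=; apply/negP=> vB.
  by have: v \in B j0 :&: W1 by [apply/setIP]; rewrite dBA inE.
- split; first by right.
  rewrite in_setU (negPf h2) orbF; apply/negP=> vA.
  by have: v \in A j0 :&: W2 by [apply/setIP]; rewrite dAB inE.
rewrite in_setU negb_or => /andP[nA nB].
by case: h => h; [left|right]; apply/setDP.
Qed.

Lemma side_j0 v c : v \in side A B (j0, c) -> v \in A j0 :|: B j0.
Proof. exact: (subsetP (side_sub A B (j0, c))). Qed.

Lemma t_E W' x : W' \in E -> t W' x -> x.1 != j0.
Proof.
move=> /EP[UW' ne1 ne2] /touchP[v vW' vx]; apply/eqP=> ej.
case: x ej vx => j c /= -> vx; have := u_uniq vx UW' vW'.
by case: c {vx}.
Qed.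

Lemma t_u c d : t (u c) (j0, d) = (d == c).
Proof.
apply/touchP/eqP => [[v vW vs]|->].
  have := u_uniq vs (uU c) vW; case: c d {vW vs} => [] [] //= e; case/eqP: W12 => //.
by have [v vs] := side_inhab parts (j0, c); exists v => //; apply: (subsetP (side_u c)).
Qed.

Lemma t_W x : t W x = (x.1 != j0) && (t (u true) x || t (u false) x).
Proof.
apply/touchP/andP => [[v /WP[vW nv] vx]|[xj /orP[] /touchP[v vW vx]]].
- split.
    apply: contraNneq nv => ej; apply: (@side_j0 v x.2).
    by rewrite -ej -surjective_pairing.
  by apply/orP; case: vW => vW; [left|right]; apply/touchP; exists v.
all: exists v => //; apply/WP; split; [by [left|right]|].
all: apply: contraNN xj => /setUP[vA|vB].
all: by [rewrite (sd vx (y := (j0, true)))|rewrite (sd vx (y := (j0, false)))].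
Qed.

(** A partition needs the merged block to be nonempty. In any transversal [W1] and [W2] cannot both
    stand on component [j0], so one of them uses a vertex of [W]. *)
Lemma W_neq0 : W != set0.
Proof.
have [F] := some_IT; case/ITP=> h1 h2; apply/eqP=> W0.
have notW v x : v \in side A B x -> v \in W1 \/ v \in W2 -> x.1 = j0.
  move=> vx vW; apply/eqP/negPn/negP => xj; have: v \in W.
    apply/WP; split=> //; apply: contraNN xj => /setUP[vA|vB].
      by rewrite (sd vx (y := (j0, true))).
    by rewrite (sd vx (y := (j0, false))).
  by rewrite W0 inE.
have /touchP[v1 vW1 vs1] := h1 W1 UW1; have /touchP[v2 vW2 vs2] := h1 W2 UW2.
have e1 := notW _ _ vs1 (or_introl vW1); have e2 := notW _ _ vs2 (or_intror vW2).
have := h2 _ _ UW1 UW2 (etrans e1 (esym e2)) => eF.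
have [d eF1] : exists d, F W1 = (j0, d) by exists (F W1).2; rewrite -e1 -surjective_pairing.
have := h1 _ UW2; have := h1 _ UW1; rewrite -eF eF1.
by have := t_u true d; have := t_u false d; rewrite /u /= => -> ->; case: d {eF1}.
Qed.

Lemma W_E : W \notin E.
Proof.
have [v vW] := set0Pn _ W_neq0; apply/negP=> /EP[UW ne1 ne2].
by case/WP: (vW) => -[] h _; [case: ne1|case: ne2]; apply: (block_uniq pU UW _ vW h).
Qed.

Lemma W_u c : W != u c.
Proof.
have [v vs] := side_inhab parts (j0, c); apply/eqP=> e.
have: v \in W by rewrite e; apply: (subsetP (side_u c)).
by case/WP=> _ /negP[]; apply: side_j0 vs.
Qed.

Lemma u_E c : u c \notin E.
Proof. by apply/EP; case: c => -[]. Qed.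

Lemma vset_contract : vset G' = vset G :\: (A j0 :|: B j0).
Proof.
apply/setP=> v; apply/idP/setDP => [/subfamily_vset[x]|].
  rewrite !inE => xj vx; split; first exact: (subsetP (side_vset x)).
  apply/negP; rewrite -in_setU => /setUP[vA|vB]; case/eqP: xj.
    by rewrite (sd vx (y := (j0, true))).
  by rewrite (sd vx (y := (j0, false))).
case=> /subfamily_vset[x _ vx] nv; apply/subfamily_vset; exists x => //.
rewrite !inE; apply: contraNneq nv => ej; apply: (@side_j0 v x.2).
by rewrite -ej -surjective_pairing.
Qed.

Lemma partition_contract : partition U' (vset G').
Proof.
have inU' W' v : W' \in U' -> v \in W' -> exists2 W'', W'' \in U & v \in W'' /\
    (W'' = W' \/ W' = W /\ W'' <> W' /\ (W'' = W1 \/ W'' = W2)).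
  case/setU1P=> [->|/EP[UW' _ _]] vW'; last by exists W' => //; split=> //; left.
  case/WP: (vW') => -[] h _; [exists W1|exists W2] => //; split=> //; right; split=> //.
    by split; [move=> e; case/eqP: (W_u true)|left].
  by split; [move=> e; case/eqP: (W_u false)|right].
apply/and3P; split.
- rewrite vset_contract; apply/eqP/setP=> v; apply/bigcupP/setDP.
    case=> W' UW' vW'; have [W'' UW'' [vW'' e]] := inU' W' v UW' vW'.
    split; first exact: (subsetP (block_sub pU UW'')).
    case/setU1P: UW' vW' => [->|/[dup] EW' /EP[UW' _ _]] vW'; first by case/WP: vW'.
    apply/negP=> /setUP[vA|vB].
      by have := @t_E W' (j0, true) EW'; rewrite eqxx; case/(_ _)/negP=> //; apply/touchP; exists v.
    by have := @t_E W' (j0, false) EW'; rewrite eqxx; case/(_ _)/negP=> //; apply/touchP; exists v.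
  case=> vG nv; have [W' UW' vW'] := in_block pU vG.
  case: (boolP (W' \in E)) => [EW'|nE]; first by exists W' => //; apply/setU1P; right.
  exists W; first exact: setU11.
  apply/WP; split=> //; move: UW' nE; rewrite U_E => /setU1P[<-|/setU1P[<-|->//]] _.
    by left.
  by right.
- apply/trivIsetP=> V1 V2 UV1 UV2; apply: contraNT => /pred0Pn[v /andP[/= v1 v2]].
  have [R1 UR1 [vR1 e1]] := inU' V1 v UV1 v1; have [R2 UR2 [vR2 e2]] := inU' V2 v UV2 v2.
  have eR := block_uniq pU UR1 UR2 vR1 vR2; move: e2; rewrite -eR => e2.
  case: e1 => [e1|[e1 [ne1 h1]]]; case: e2 => [e2|[e2 [ne2 h2]]].
  + by rewrite -e1 e2.
  + case/setU1P: UV1 => [e|/EP[_ n1 n2]]; first by rewrite e e2.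
    by case: h2 => h2; [case: n1|case: n2]; rewrite -e1.
  + case/setU1P: UV2 => [e|/EP[_ n1 n2]]; first by rewrite e e1.
    by case: h1 => h1; [case: n1|case: n2]; rewrite -e2.
  + by rewrite e1 e2.
apply/negP=> /setU1P[e|/EP[U0 _ _]]; first by case/negP: W_neq0; rewrite -e.
by case/and3P: pU => _ _ /negP.
Qed.

Lemma card_contract : #|U'| = n.
Proof.
move: cU; rewrite U_E !cardsU1 W_E (u_E false) in_setU1 negb_or W12 (u_E true) /=.
by rewrite !add1n => -[].
Qed.

Lemma minimal_contract : minimally_RGD G' U'.
Proof.
have rG' := subfamily_represents parts indep x0 [set~ j0].
have utf : u true != u false by [].
split.
- apply/(RG_nonemptyP sd partition_contract rG').
  apply: (contract_IT W_E t_W t_u); have [F iF] := some_IT; exists F.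
  by move: iF; rewrite {1}U_E.
- move=> /(RG_connectedP sd partition_contract rG') h; apply: full_conn => F F'.
  by rewrite {1 2 3}U_E; apply: expand_conn u_E W_E utf t_E t_W t_u h _ _.
move=> V UV; apply/(RG_connectedP sd (partition_del partition_contract UV)
  (represents_del V rG')).
case/setU1P: (UV) => [->|EV].
  rewrite setU1K ?W_E //.
  apply: (contract_del_conn u_E t_E t_u (c := true)).
  (* Deleting the merged block leaves [E], which is compared with the deletion of [W2] alone. *)
  have <- : U :\ W2 = u true |: E.
    apply/setP=> W'; rewrite in_setD1 in_setU1 !in_setD1 /u /=.
    by case: (W' =P W1) => [->|_] //; rewrite W12 UW1.
  exact: del_conn.
(* Deleting any other block V commutes with merging, so the contraction is applied to [E :\ V]. *)
have sE : E :\ V \subset E by apply: subD1set.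
have u_E' c : u c \notin E :\ V by apply: contraNN (u_E c); apply: (subsetP sE).
have W_E' : W \notin E :\ V by apply: contraNN W_E; apply: (subsetP sE).
have t_E' W' x : W' \in E :\ V -> t W' x -> x.1 != j0.
  by move=> /(subsetP sE); apply: t_E.
have -> : U' :\ V = W |: (E :\ V).
  by rewrite /U' setDUl; congr (_ :|: _); apply/setDidPl; rewrite disjoints1 in_set1;
     apply: contraNneq W_E => ->.
apply: (contract_conn u_E' W_E' utf t_E' t_W t_u).
have eU : U :\ V = u true |: (u false |: (E :\ V)).
  have /EP[_ n1 n2] := EV.
  apply/setP=> W'; rewrite {1}U_E in_setD1 !in_setU1 (in_setD1 _ E) /u.
  case: (W' =P V) => [->|_] //=.
  by move/eqP/negPf: n1 => ->; move/eqP/negPf: n2 => ->.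
rewrite -eU; apply: del_conn; by case/EP: EV.
Qed.

Lemma split_contract : split_block (G', U') (G, U).
Proof.
have [nA nB dAB] := parts j0.
have -> : G = graph_union G' (complete_bipartite (A j0) (B j0)).
  rewrite /graph_union /G /G' /subfamily /=; congr Graph.
    rewrite (bigD1 j0) ?inE //= setUC; congr (_ :|: _).
    by apply: eq_bigl => i; rewrite !inE.
  rewrite (bigD1 j0) ?inE //= setUC; congr (_ :|: _).
  by apply: eq_bigl => i; rewrite !inE.
have -> : U = (U' :\ W) :|: [set A j0 :|: X; B j0 :|: Y].
  have -> : A j0 :|: X = W1 by rewrite /X -{1}(setIidPr AW) setID.
  have -> : B j0 :|: Y = W2 by rewrite /Y -{1}(setIidPr BW) setID.
  by rewrite setU1K ?W_E // {1}U_E (setUC E) -setUA.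
apply: SplitBlock => //; first exact: setU11.
  rewrite vset_contract -setI_eq0; apply/eqP/setP=> v; rewrite in_set0.
  by apply/negP=> /setIP[h /setDP[_ /negP]].
rewrite -setI_eq0; apply/eqP/setP=> v; rewrite in_set0; apply/negP=> /setIP[/setDP[h1 _] /setDP[h2 _]].
by case/eqP: W12; apply: (block_uniq pU UW1 UW2 h1 h2).
Qed.

Lemma family_contract :
  disjoint_union_Kab G' (fun i : 'I_n => A (lift j0 i)) (fun i => B (lift j0 i)).
Proof.
split=> [i|i j ij|]; first exact: parts.
  by apply: indep; apply: contraNneq ij => /lift_inj->.
rewrite big_graph_unionE /G' /subfamily.
have re (R : finType) (F : 'I_n.+1 -> {set R}) :
    \bigcup_(i in [set~ j0]) F i = \bigcup_(i in [set: 'I_n]) F (lift j0 i).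
  apply/setP=> v; apply/bigcupP/bigcupP => -[i iR vi].
    case: (unliftP j0 i) iR vi => [j ->|->]; last by rewrite !inE eqxx.
    by move=> _ vj; exists j; rewrite ?inE.
  by exists (lift j0 i) => //; rewrite !inE eq_sym neq_lift.
by rewrite !re.
Qed.

End Contractible.

Lemma elementary_of_rigid :
  (forall W1 W2 j, W1 \in U -> W2 \in U -> A j \subset W1 -> B j \subset W2 -> W1 = W2) ->
  elementary G U.
Proof.
move=> rigid; split=> //.
pose f W := odflt x0 [pick x | side A B x \subset W].
have fP W : W \in U -> side A B (f W) \subset W.
  move=> UW; rewrite /f; case: pickP => // h.
  by have [x hx] := block_contains_side UW; rewrite h in hx.
have f_inj : {in U &, injective (fun W => (f W).1)}.
  move=> W W' UW UW'; have := fP W UW; have := fP W' UW'.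
  case: (f W) (f W') => i b [j c] + + /= eij; rewrite -eij => {j eij}.
  case: b c => [] [] s s'.
  - have [v vs] := side_inhab parts (i, true).
    by apply: (block_uniq pU UW UW' (v := v)); [apply: (subsetP s')|apply: (subsetP s)].
  - exact: rigid s' s.
  - by symmetry; apply: rigid s s'.
  - have [v vs] := side_inhab parts (i, false).
    by apply: (block_uniq pU UW UW' (v := v)); [apply: (subsetP s')|apply: (subsetP s)].
have f_onto i : exists2 W, W \in U & (f W).1 = i.
  have : [set (f W).1 | W in U] = setT.
    by apply/eqP; rewrite eqEcard subsetT cardsT card_ord (card_in_imset f_inj) cU leqnn.
  by move/setP/(_ i); rewrite inE => /imsetP[W UW ->]; exists W.
pose P i := odflt set0 [pick W in U | (f W).1 == i].
have PP i : P i \in U /\ (f (P i)).1 = i.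
  rewrite /P; case: pickP => [W /andP[UW /eqP]|h] //.
  by have [W UW e] := f_onto i; have := h W; rewrite /= UW e eqxx.
(* The side contained in the associated block may be either part, whereas [elementary] wants it to
   be the first one; swapping the parts of a component does not change G. *)
have eqG : G = subfamily (fun i => side A B (i, (f (P i)).2))
                         (fun i => side A B (i, ~~ (f (P i)).2)) setT.
  rewrite /G /subfamily; congr Graph; apply: eq_bigr => i _; rewrite /side /=.
    by case: (f (P i)).2 => //=; rewrite setUC.
  case: (f (P i)).2 => //=; apply/setP=> e.
  by apply/imset2P/imset2P => -[a b ha hb ->]; exists b a => //; rewrite setUC.
exists n.+1, (fun i => side A B (i, (f (P i)).2)), (fun i => side A B (i, ~~ (f (P i)).2)), P.
have U_P : U = [set P i | i : 'I_n.+1].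
  apply/setP=> W; apply/idP/imsetP => [UW|[i _ ->]]; last by case: (PP i).
  exists (f W).1 => //; have [UP e] := PP (f W).1; exact: f_inj.
split.
- split; last by rewrite big_graph_unionE.
    move=> i; case: (f (P i)).2; rewrite /side /=; first exact: parts.
    by have [h1 h2 h3] := parts i; split; rewrite // disjoint_sym.
  move=> i j ij; rewrite /side /=.
  by case: (f (P i)).2; case: (f (P j)).2 => /=; rewrite ?(setUC (B i)) ?(setUC (B j));
     apply: indep.
- split=> // i j e; have [_ <-] := PP i; by rewrite e; case: (PP j).
- by move=> i; have [UP e] := PP i; rewrite -{1}e -surjective_pairing; apply: fP.
- by move=> i; have [_ _ h] := mU; apply: h; case: (PP i).
Qed.

End Step.

Lemma structure n G U (A B : 'I_n -> {set T}) :
  disjoint_union_Kab G A B -> partition U (vset G) -> #|U| = n ->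
  minimally_RGD G U ->
  elementary G U \/
  exists (G0 : graph T) (U0 : {set {set T}}),
    elementary G0 U0 /\ clos_trans _ (@split_block T) (G0, U0) (G, U).
Proof.
elim: n G U A B => [|n IH] G U A B [parts indep ->]; rewrite big_graph_unionE => pU cU mU.
  (* Without blocks the empty set is the only possible transversal, so the instance would be
     connected. *)
  exfalso; have [_ nc _] := mU; apply: nc; have U0 := cards0_eq cU.
  have V0 : vset (subfamily A B setT) = set0.
    by case/and3P: pU => /eqP<- _ _; rewrite U0 /cover big_set0.
  have S0 S : is_IT (subfamily A B setT) U S -> S = set0.
    by case/andP=> /andP[SV _] _; apply/eqP; rewrite -subset0 -V0.
  by move=> S S' /S0-> /S0->; apply: connect0.
case: (boolP [exists j, [exists W1 in U, [exists W2 in U,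
    [&& W1 != W2, A j \subset W1 & B j \subset W2]]]]).
  case/existsP=> j /exists_inP[W1 UW1 /exists_inP[W2 UW2 /and3P[W12 AW BW]]]; right.
  have sp := split_contract parts indep pU mU UW1 UW2 W12 AW BW.
  have [el|[G0 [U0 [el c]]]] := IH _ _ _ _ (family_contract parts indep j)
    (partition_contract parts indep pU mU UW1 UW2 W12 AW BW)
    (card_contract parts indep pU cU mU UW1 UW2 W12 AW BW)
    (minimal_contract parts indep pU mU UW1 UW2 W12 AW BW).
    by eexists _, _; split; [exact: el|apply: t_step sp].
  by exists G0, U0; split=> //; apply: t_trans c (t_step _ _ _ _ sp).
move=> /existsPn nc; left; apply: elementary_of_rigid => // W1 W2 j UW1 UW2 AW BW.
apply/eqP/negPn/negP => W12; case/negP: (nc j); apply/exists_inP; exists W1 => //.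
by apply/exists_inP; exists W2 => //; rewrite W12 AW.
Qed.

End Structure.

Theorem theorem2p4 (T : finType) (G : graph T) (U : {set {set T}})
    (hG : simple_graph G) (hU : partition U (vset G))
    (ha : minimally_RGD G U)
    (hb : exists (n : nat) (A B : 'I_n -> {set T}), disjoint_union_Kab G A B)
    (hc : num_components G = #|U|) :
  elementary G U \/
  exists (G0 : graph T) (U0 : {set {set T}}),
    elementary G0 U0 /\ clos_trans _ (@split_block T) (G0, U0) (G, U).
Proof.
have [n [A [B dK]]] := hb; apply: structure (dK) hU _ ha; rewrite -hc.
have [parts indep ->] := dK; rewrite big_graph_unionE.
(* A default label exists only if there is a component; with none, the vertex set is empty and the
   count is 0. *)
case: n A B {dK} parts indep => [|n] A B parts indep; last first.
  exact: num_components_family parts indep (ord0, true).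
apply: eq_card0 => v; rewrite !inE /=.
by apply/negP=> /andP[_ /bigcupP[[]]].
Qed.
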